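(* Let $n\ge 2$ and let $\mathrm{QP}_{n+1}$ be the bi-cyclopermutohedron. For integers $i$ put $\xi(n,i)=\sum_{k=0}^{i}\binom{n}{k}$. Then the homology of $\mathrm{QP}_{n+1}$ with coefficients in $\mathbb{Z}_2=\mathbb{Z}/2\mathbb{Z}$ is $$H_i(\mathrm{QP}_{n+1},\mathbb{Z}_2)\cong\begin{cases}\displaystyle\bigoplus_{\xi(n,i)}\mathbb{Z}_2, & 0\le i\le n-2,\\ 0, & \text{otherwise,}\end{cases}$$ where $\bigoplus_{m}G$ denotes the direct sum of $m$ copies of $G$.
   Context: Write $[n+1]=\{1,\dots,n+1\}$. A linearly ordered partition of $[n+1]$ into $m$ blocks is a tuple $(I_1,\dots,I_m)$ of nonempty pairwise disjoint subsets with union $[n+1]$. A cyclically ordered partition is an equivalence class of linearly ordered partitions under cyclic permutation of the blocks; it is always represented by the linearly ordered partition in which the block containing $n+1$ comes last. The cyclopermutohedron $\mathrm{CP}_{n+1}$ is the regular CW complex of dimension $n-2$ whose $k$-cells, $0\le k\le n-2$, are labeled by all cyclically ordered partitions of $[n+1]$ into $n-k+1$ blocks (so there are always at least 3 blocks). A closed cell $F$ contains a cell $F'$ iff the label of $F'$ refines the label of $F$ in an orientation-preserving way, i.e. the label of $F$ is obtained from that of $F'$ by replacing runs of cyclically consecutive blocks by their unions, keeping the cyclic order. (A regular CW complex is determined up to homeomorphism by its face poset.) The map $r:(I_1,I_2,\dots,I_{k-1},I_k)\mapsto(I_{k-1},\dots,I_2,I_1,I_k)$ (with $n+1\in I_k$)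 is a fixed-point-free cellular involution of $\mathrm{CP}_{n+1}$. The bi-cyclopermutohedron is the quotient $\mathrm{QP}_{n+1}=\mathrm{CP}_{n+1}/\mathbb{Z}_2$ by this involution. It is a regular CW complex whose $k$-cells, $0\le k\le n-2$, are labeled by bi-cyclically ordered partitions of $[n+1]$ into $n-k+1$ blocks, i.e. classes $\{\lambda,r(\lambda)\}$ of cyclically ordered partitions; a closed cell contains a cell $F'$ iff the label of $F'$ refines its label (i.e. some representative of the label of $F'$ refines some representative of the other label). *)

(* Defs.v *)
From HB Require Import structures.
From mathcomp Require Import all_boot all_order all_algebra all_fingroup.

Set Implicit Arguments.
Unset Strict Implicit.
Unset Printing Implicit Defensive.

Import Order.TTheory GRing.Theory Num.Theory GroupScope.

Local Open Scope nat_scope.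

(* The set [n+1] = {1, ..., n+1} is 'I_n.+1, where the ordinal i stands for
   i + 1; in particular ord_max stands for n+1. *)

Definition ordered_partition (n : nat) (s : seq {set 'I_n.+1}) : bool :=
  [&& set0 \notin s,
      pairwise (fun A B : {set 'I_n.+1} => [disjoint A & B]) s
    & \bigcup_(A <- s) A == [set: 'I_n.+1]].

(* Bounding the length by n+1 loses no ordered partition of [n+1], and makes
   the type of labels finite. *)
Notation label n := ((n.+1).-bseq {set 'I_n.+1}).

(* A cyclically ordered partition is represented by the linearly ordered
   partition in which the block containing n+1 comes last. *)
Definition cyclic_partition (n : nat) (s : label n) : bool :=
  ordered_partition s && (ord_max \in last set0 s).

(* Up to a cyclic permutation of its blocks, s is cut into runs of lengths
   sh_1, sh_2, ..., all positive, and the unions of the runs are the blocks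
   of t. *)
Definition refines (n : nat) (s t : label n) : bool :=
  [exists k : 'I_(size s), exists sh : (size t).-tuple 'I_(size s).+1,
     let lens := [seq val l | l <- sh] in
     [&& 0 \notin lens, sumn lens == size s
       & [seq \bigcup_(A <- run) A | run <- reshape lens (rot k s)] == t]].

(* (I_1, ..., I_(k-1), I_k) |-> (I_(k-1), ..., I_1, I_k) *)
Definition reversal (n : nat) (s : label n) : label n := [bseq of rot 1 (rev s)].

(* The cells of CP_{n+1}: their dimensions 0, ..., n-2 correspond to the
   numbers of blocks n+1, ..., 3. *)
Definition cp_label (n : nat) (s : label n) : bool :=
  cyclic_partition s && (3 <= size s).

(* The cells of QP_{n+1}: the orbits {s, r(s)} of the cells of CP_{n+1}. *)
Definition qp_cell (n : nat) : Type :=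
  {C : {set label n} |
    [exists s : label n, cp_label s && (C == [set s; reversal s])]}.

HB.instance Definition _ (n : nat) := Finite.on (qp_cell n).

(* Both labels in an orbit have the same number of blocks. *)
Definition nblocks (n : nat) (F : qp_cell n) : nat := \max_(s in val F) size s.

(* A k-cell is labelled by partitions into n - k + 1 blocks. *)
Definition dim (n : nat) (F : qp_cell n) : int :=
  (n%:Z - (nblocks F)%:Z + 1)%R.

Definition face (n : nat) (F' F : qp_cell n) : bool :=
  [exists s' in val F', exists s in val F, refines s' s].

(* The cellular chain complex of QP_{n+1} with coefficients in Z/2. All degrees
   are gathered in the single group chain n, the chains of degree i being those
   supported on the i-cells. In a regular CW complex the incidence number of an
   i-cell and an (i-1)-cell is +1 or -1 when the latter is a face of the former
   and 0 otherwise, hence it is 1 or 0 modulo 2. *)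
Definition chain (n : nat) : Type := {ffun qp_cell n -> 'Z_2}.

HB.instance Definition _ (n : nat) := Finite.on (chain n).
HB.instance Definition _ (n : nat) := GRing.Zmodule.on (chain n).
HB.instance Definition _ (n : nat) := [finGroupMixin of chain n for +%R].

Definition incidence (n : nat) (F F' : qp_cell n) : 'Z_2 :=
  if (dim F == dim F' + 1)%R && face F' F then 1%R else 0%R.

Definition boundary (n : nat) (c : chain n) : chain n :=
  [ffun F' => \sum_(F : qp_cell n) incidence F F' * c F]%R.

Lemma boundaryM (n : nat) : {in setT &, {morph @boundary n : c d / (c * d)%g}}.
Proof.
move=> c d _ _; apply/ffunP=> F; rewrite !ffunE -big_split /=.
by apply: eq_bigr => G _; rewrite ffunE mulrDr.
Qed.

Canonical boundary_morphism (n : nat) := Morphism (@boundaryM n).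

Definition chains_set (n : nat) (i : int) : {set chain n} :=
  [set c : chain n | [forall F : qp_cell n, (dim F != i) ==> (c F == 0%R)]].

Lemma chains_group_set (n : nat) (i : int) : group_set (chains_set n i).
Proof.
apply/group_setP; split=> [|c d]; rewrite !inE.
  by apply/forall_inP=> F _; rewrite ffunE.
move=> /forall_inP c0 /forall_inP d0; apply/forall_inP=> F Fi.
by rewrite ffunE (eqP (c0 F Fi)) (eqP (d0 F Fi)) addr0.
Qed.

Definition chains (n : nat) (i : int) : {group chain n} :=
  Group (chains_group_set n i).

Definition cycles (n : nat) (i : int) : {group chain n} :=
  'ker_(chains n i) (@boundary n).

Definition boundaries (n : nat) (i : int) : {group chain n} :=
  @boundary n @* chains n (i + 1)%R.

Definition homology (n : nat) (i : int) := (cycles n i / boundaries n i)%G.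

Definition xi (n i : nat) : nat := \sum_(k < i.+1) 'C(n, k).

(* Main.v *)
From HB Require Import structures.
Require Import Defs.
From mathcomp Require Import all_boot all_order all_algebra all_fingroup zify.

(** A cyclically ordered partition of the ground set into [p.+1] blocks is a word
    of length [n] over [{0, .., p}] in which [1], .., [p] all occur: the letter at
    [i] is the number of the block of [i], and block [0] is the one that contains
    the largest element. To merge two cyclically consecutive blocks is to apply a
    face map of the simplicial circle to all letters. So the words are the
    nondegenerate simplices of the [n]-th power of the simplicial circle, a torus,
    and reversal of labels is inversion on this torus. A chain of the quotient
    complex, in degree [n - p], is a reversal-invariant function on words, and its
    boundary, a sum over coarsenings, is the simplicial coboundary
    ([boundary_orbit], [coboundary_lift_chain]).

    For [p] at least [2] reversal acts freely on words, so mod 2 the invariant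
    functions are the functions [norm u = u + reverse u]. The homology in degree
    [n - p] is therefore the space of all [u] with [norm (coboundary u) = 0] modulo
    those with [norm u = norm (coboundary v)] for some [v]. In degree [p = 1], where
    reversal is trivial, it is replaced by the space of all functions, which has
    dimension [2 ^ n - 1].

    The dimension is found by induction on [n]. To forget one letter is a
    projection of tori with a circle as fibre. Integration along the fibre, [push],
    and restriction to the zero section, [restrict], together identify the
    cohomology of length [n.+1] in degree [p.+2] with the sum of those of length [n]
    in degrees [p.+1] and [p.+2] ([betti_step]). Injectivity comes from a prism
    homotopy ([coboundary_slide]). For surjectivity, classes on the base are pulled
    back by [extend], and [push] has the section [suspend]; the latter does not
    commute with reversal, but it is homotopic to its conjugate
    ([coboundary_extend_inner]), by a homotopy that does, and mod 2 this suffices to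
    correct it ([cocycle_lift]). By Pascal's rule, the dimension in degree [p] is the
    sum of the binomial coefficients ['C(n, j)] with [j] at least [p], that is,
    [xi n (n - p)]. *)

Set Implicit Arguments.
Unset Strict Implicit.
Unset Printing Implicit Defensive.

Import GRing.Theory.

Local Open Scope nat_scope.

(** * Words and formal sums of words *)

(** The [j]-th face map of the simplicial circle: blocks [j] and [j.+1] become
    one. Blocks are cyclically ordered, so for [j = p] the last block is absorbed
    by block [0], the one that contains the largest element of the ground set. *)
Definition merge_blocks (p j x : nat) : nat :=
  if (j == p) && (x == p) then 0 else if j < x then x.-1 else x.

(** The [j]-th degeneracy map: it frees the block number [j.+1]. *)
Definition expand (j x : nat) : nat := if j < x then x.+1 else x.

(** Block [0] stays in place, because a cyclic label always ends with it. *)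
Definition flip (p x : nat) : nat := if x == 0 then 0 else p.+1 - x.

(** Piecewise linear identities: all cases are decided by linear arithmetic. *)
Ltac arith := rewrite /merge_blocks /expand /flip;
  repeat match goal with |- context [if ?b then _ else _] =>
    lazymatch b with context [if _ then _ else _] => fail | _ => case: (boolP b) => ? end
  end; lia.

Definition bounded (p : nat) (w : seq nat) : bool := all (fun x => x <= p) w.

Lemma eq_map_bounded p (f g : nat -> nat) w :
  (forall x, x <= p -> f x = g x) -> bounded p w -> map f w = map g w.
Proof. by move=> fg /allP wp; apply/eq_in_map=> x /wp; apply: fg. Qed.

Lemma bounded_map p q (f : nat -> nat) w :
  (forall x, x <= p -> f x <= q) -> bounded p w -> bounded q (map f w).
Proof. by move=> fpq /allP wp; apply/allP=> _ /mapP[x /wp xp ->]; apply: fpq. Qed.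

(** Every operator below pulls functions back along a map [k] from words to
    finite formal sums of words, encoded as lists. A common shape makes additivity
    and compositions a matter of two lemmas. *)
Definition sum_along (k : seq nat -> seq (seq nat)) (f : seq nat -> 'Z_2)
    (w : seq nat) : 'Z_2 :=
  (\sum_(v <- k w) f v)%R.

Definition faces p w := [seq map (merge_blocks p j) w | j <- index_iota 0 p.+1].
Definition mirror p w := [:: map (flip p) w].

(** The first letter becomes a new singleton block, in each of the gaps between
    cyclically consecutive blocks. *)
Definition gaps p w := [seq j.+1 :: map (expand j) w | j <- index_iota 0 p.+1].
Definition in_base (w : seq nat) := [:: 0 :: w].
Definition forget (w : seq nat) := if w is _ :: v then [:: v] else [::].
Definition forget_inner (w : seq nat) :=
  if w is x :: v then if x == 0 then [::] else [:: v] else [::].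

(** The pullback along it is the cup product with the generating 1-cocycle of the
    circle: a front face of [w] and the last edge of [x]. *)
Definition absorb_last p (w : seq nat) :=
  if w is x :: v then if x == p then [:: map (merge_blocks p p) v] else [::] else [::].

(** The new singleton block sweeps over the gaps from block [0] up to the block
    that contained the first letter. *)
Definition sweep (w : seq nat) :=
  if w is x :: v then [seq j.+1 :: map (expand j) v | j <- index_iota 0 x] else [::].

(** * Mod 2 sums over triangles *)

Section Sums.
Local Open Scope ring_scope.
Implicit Types (F : nat -> nat -> 'Z_2) (c : nat -> 'Z_2) (f : seq nat -> 'Z_2).

Lemma Z2_addxx (x : 'Z_2) : x + x = 0.
Proof. by case: x => [[|[|]] i] //; apply: val_inj. Qed.

Lemma Z2_opp (x : 'Z_2) : - x = x.
Proof. by apply/eqP; rewrite eq_sym -addr_eq0 Z2_addxx. Qed.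

Lemma Z2_eq (x y : 'Z_2) : x + y = 0 -> x = y.
Proof. by move/eqP; rewrite addr_eq0 Z2_opp => /eqP. Qed.

Lemma telescope_sum c x : \sum_(0 <= j < x) (c j + c j.+1) = c 0%N + c x.
Proof.
elim: x => [|x IHx]; first by rewrite big_geq // Z2_addxx.
by rewrite big_nat_recr //= IHx addrA -(addrA (c 0%N)) Z2_addxx addr0.
Qed.

(** To skip the position [i] and shift the later ones down enumerates the range
    without its last element; if [i] lies beyond the range, nothing is skipped. *)
Lemma sum_skip i x c :
  \sum_(0 <= j < x) (if (i < j)%N then c j.-1 else if (j < i)%N then c j else 0) =
  \sum_(0 <= j < (if (i < x)%N then x.-1 else x)) c j.
Proof.
elim: x => [|x IHx]; first by rewrite !big_geq.
rewrite big_nat_recr // IHx /= ltnS; case: (ltngtP i x) => [ix|xi|eix].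
- by case: x ix {IHx} => // x _; rewrite big_nat_recr.
- by rewrite big_nat_recr.
- by rewrite addr0.
Qed.

(** The terms below the diagonal are matched with those on or above it; this is
    the usual reason why the composite of two coboundaries vanishes. *)
Lemma box_cancel m F :
    (forall i j, (j < i <= m)%N -> F i j = F j i.-1) ->
  \sum_(0 <= i < m.+1) \sum_(0 <= j < m) F i j = 0.
Proof.
move=> symF.
have -> : \sum_(0 <= i < m.+1) \sum_(0 <= j < m) F i j =
  \sum_(0 <= i < m.+1) \sum_(0 <= j < m) (if (j < i)%N then F j i.-1 else 0) +
  \sum_(0 <= i < m.+1) \sum_(0 <= j < m) (if (j < i)%N then 0 else F i j).
  rewrite -big_split; apply: eq_big_nat => i /andP[_ im].
  rewrite -big_split; apply: eq_big_nat => j /andP[_ jm].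
  by rewrite /=; case: ifP => ji; rewrite ?addr0 ?add0r // symF // ji.
set S1 := (X in X + _ = _); set S2 := (X in _ + X = _).
suff -> : S1 = S2 by rewrite Z2_addxx.
rewrite /S1 /S2 big_nat_recl // big_nat_recr //= big1 // add0r.
rewrite [X in _ + X]big_nat [X in _ + X]big1 ?addr0; last by move=> j /andP[_ ->].
rewrite exchange_big_nat /=; apply: eq_bigr => i _; apply: eq_bigr => j _.
by rewrite ltnS; case: leqP.
Qed.

(** The combinatorics of a prism operator: off the two diagonals [i = j] and
    [i = j.+1], faces and degeneracies commute up to a shift of indices, and this
    reorders the sum; the two diagonals are the end faces of the prism. *)
Lemma prism_sum p x (A B : nat -> nat -> 'Z_2) :
    (x <= p.+1)%N ->
    (forall i j, (i < j < x)%N -> A i j = B i j.-1) ->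
    (forall i j, (j < x)%N -> (j.+1 < i <= p.+1)%N -> A i j = B i.-1 j) ->
  \sum_(0 <= j < x) \sum_(0 <= i < p.+2) A i j =
  \sum_(0 <= j < x) (A j j + A j.+1 j) +
  \sum_(0 <= i < p.+1) \sum_(0 <= j < (if (i < x)%N then x.-1 else x)) B i j.
Proof.
move=> xp Alt Agt.
under [X in _ + X]eq_bigr => i _ do rewrite -sum_skip.
rewrite [X in _ + X]exchange_big_nat -big_split /=; apply: eq_big_nat => j /andP[_ jx].
have [jp jp1 jp2] : [/\ j <= p, j <= p.+1 & j <= p.+2]%N by split; lia.
rewrite (big_cat_nat (n := j)) //= [X in _ + X]big_ltn //.
rewrite [X in _ + (_ + X)]big_ltn ?ltnS // big_add1 /=.
rewrite [X in _ = _ + X](big_cat_nat (n := j)) //=.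
rewrite [X in _ = _ + (_ + X)]big_ltn ?ltnS // ltnn add0r.
rewrite addrC -!addrA [X in _ + (_ + X)]addrC; congr (_ + (_ + (_ + _))).
  by apply: eq_big_nat => i /andP[_ ij]; rewrite ij Alt ?ij.
apply: eq_big_nat => i /andP[ji ip].
by rewrite ltnNge (ltnW ji) /= ji Agt //; lia.
Qed.
End Sums.

(** * The simplicial identities and their homotopies *)

Lemma merge_merge p i j x : j < i <= p.+2 -> x <= p.+2 ->
  merge_blocks p.+1 j (merge_blocks p.+2 i x) =
    merge_blocks p.+1 i.-1 (merge_blocks p.+2 j x).
Proof. arith. Qed.

Lemma flip_merge p j x : j <= p.+1 -> x <= p.+1 ->
  flip p (merge_blocks p.+1 j x) = merge_blocks p.+1 (p.+1 - j) (flip p.+1 x).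
Proof. arith. Qed.

Lemma merge_expand_lt p i j x : i < j <= p.+1 -> x <= p.+1 ->
  merge_blocks p.+2 i (expand j x) = expand j.-1 (merge_blocks p.+1 i x).
Proof. arith. Qed.

Lemma merge_expand_gt p i j x : j.+1 < i <= p.+2 -> x <= p.+1 ->
  merge_blocks p.+2 i (expand j x) = expand j (merge_blocks p.+1 i.-1 x).
Proof. arith. Qed.

Lemma bounded_cons p x w : bounded p (x :: w) = (x <= p) && bounded p w.
Proof. by []. Qed.

Section Identities.
Local Open Scope ring_scope.
Implicit Types (f : seq nat -> 'Z_2) (w : seq nat).

Lemma sum_faces p f w :
  sum_along (faces p) f w = \sum_(0 <= j < p.+1) f (map (merge_blocks p j) w).
Proof. by rewrite /sum_along big_map. Qed.

Lemma sum_gaps p f w :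
  sum_along (gaps p) f w = \sum_(0 <= j < p.+1) f (j.+1 :: map (expand j) w).
Proof. by rewrite /sum_along big_map. Qed.

Lemma sum_sweep f x w :
  sum_along sweep f (x :: w) = \sum_(0 <= j < x) f (j.+1 :: map (expand j) w).
Proof. by rewrite /sum_along big_map. Qed.

Lemma sum_mirror p f w : sum_along (mirror p) f w = f (map (flip p) w).
Proof. by rewrite /sum_along big_seq1. Qed.

Lemma sum_in_base f w : sum_along in_base f w = f (0%N :: w).
Proof. by rewrite /sum_along big_seq1. Qed.

Lemma sum_forget f x w : sum_along forget f (x :: w) = f w.
Proof. by rewrite /sum_along big_seq1. Qed.

Lemma sum_forget_inner f x w :
  sum_along forget_inner f (x :: w) = if x == 0%N then 0 else f w.
Proof. by rewrite /sum_along /=; case: eqP; rewrite ?big_nil ?big_seq1. Qed.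

Lemma sum_absorb_last p f x w :
  sum_along (absorb_last p) f (x :: w) = if x == p then f (map (merge_blocks p p) w) else 0.
Proof. by rewrite /sum_along /=; case: eqP; rewrite ?big_nil ?big_seq1. Qed.

Definition sum_alongE := (sum_faces, sum_gaps, sum_sweep, sum_mirror,
  sum_in_base, sum_forget, sum_forget_inner, sum_absorb_last).

Lemma faces_faces p f w : bounded p.+2 w ->
  sum_along (faces p.+2) (sum_along (faces p.+1) f) w = 0.
Proof.
move=> wp; rewrite sum_faces; under eq_bigr => i _ do rewrite sum_faces.
apply: box_cancel => i j ji; congr f; rewrite -!map_comp.
by apply: eq_map_bounded wp => x; apply: merge_merge.
Qed.

Lemma faces_mirror p f w : bounded p.+1 w ->
  sum_along (faces p.+1) (sum_along (mirror p) f) w =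
  sum_along (mirror p.+1) (sum_along (faces p.+1) f) w.
Proof.
move=> wp; rewrite !sum_alongE [RHS]big_nat_rev; apply: eq_big_nat => j /andP[_ jp].
rewrite sum_mirror; congr f; rewrite -!map_comp.
apply: eq_map_bounded wp => x xp /=.
by rewrite flip_merge // add0n subSS.
Qed.

Lemma expandK p j w : bounded p w -> map (merge_blocks p.+1 j) (map (expand j) w) = w.
Proof.
move=> wp; rewrite -map_comp -[RHS]map_id; apply: eq_map_bounded wp => x /=; arith.
Qed.

Lemma expandK' p j w : (j <= p)%N -> bounded p w ->
  map (merge_blocks p.+1 j.+1) (map (expand j) w) = w.
Proof.
move=> jp wp; rewrite -map_comp -[RHS]map_id; apply: eq_map_bounded wp => x /=; arith.
Qed.

(** When the singleton [j.+1] is merged with a neighbour, the letter enters block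
    [j] or block [j.+1]; around the circle each block is entered twice. *)
Lemma gaps_faces p f w : bounded p.+1 w ->
  sum_along (gaps p.+1) (sum_along (faces p.+2) f) w =
  sum_along (faces p.+1) (sum_along (gaps p) f) w.
Proof.
move=> wp; rewrite !sum_alongE; under eq_bigr => i _ do rewrite sum_faces.
under [RHS]eq_bigr => i _ do rewrite sum_gaps.
rewrite (@prism_sum p.+1 p.+2 (fun i j => f (map (merge_blocks p.+2 i) (j.+1 :: map
  (expand j) w)))
  (fun i j => f (j.+1 :: map (expand j) (map (merge_blocks p.+1 i) w)))) //; last 2 first.
- move=> i j ij; congr f => /=; congr (_ :: _); first by arith.
  by rewrite -!map_comp; apply: eq_map_bounded wp => x /=; apply: merge_expand_lt.
- move=> i j jp ij; congr f => /=; congr (_ :: _); first by arith.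
  by rewrite -!map_comp; apply: eq_map_bounded wp => x /=; apply: merge_expand_gt.
rewrite [X in X + _](_ : _ = 0) ?add0r.
  by apply: eq_big_nat => i /andP[_ ip]; rewrite ip.
(* Around the circle, block [p.+2] is block [0] again. *)
pose c j := f ((if j == p.+2 then 0 else j)%N :: w).
rewrite [LHS](eq_big_nat _ _ (F2 := fun j => c j + c j.+1)).
  by rewrite telescope_sum /c eqxx Z2_addxx.
move=> j /andP[_ jp]; rewrite /c /= expandK // expandK' //.
by congr (f (_ :: _) + f (_ :: _)); arith.
Qed.

Lemma gaps_mirror p f w : bounded p w ->
  sum_along (gaps p) (sum_along (mirror p.+1) f) w =
    sum_along (mirror p) (sum_along (gaps p) f) w.
Proof.
move=> wp; rewrite !sum_alongE [RHS]big_nat_rev; apply: eq_big_nat => j /andP[_ jp].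
rewrite sum_mirror; congr f => /=; congr (_ :: _); first by arith.
by rewrite -!map_comp; apply: eq_map_bounded wp => x xp /=; arith.
Qed.

(** A face sends [x] to the last block either from the last block itself, or, if
    [x = p.+1], through the two faces that agree on the rest of the word. *)
Lemma absorb_faces p f x w : bounded p.+2 (x :: w) ->
  sum_along (faces p.+2) (sum_along (absorb_last p.+1) f) (x :: w) =
  sum_along (absorb_last p.+2) (sum_along (faces p.+1) f) (x :: w).
Proof.
rewrite bounded_cons => /andP[xp wp]; rewrite !sum_alongE.
under eq_bigr => i _ do rewrite /= sum_absorb_last.
have [->|xNp] := eqVneq x p.+2.
  rewrite big_nat_recr //= [X in _ + X](_ : _ = 0) ?addr0; last first.
    by rewrite /merge_blocks !eqxx.
  apply: eq_big_nat => j /andP[_ jp].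
  rewrite ifT; last by arith.
  by congr f; rewrite -!map_comp; apply: eq_map_bounded wp => y yp /=; arith.
have [->|xNp'] := eqVneq x p.+1.
  rewrite big_nat_recr // big_nat_recr //= big_nat big1 ?add0r; last first.
    by move=> j /andP[_ jp]; rewrite ifF //; arith.
  rewrite !ifT; try by arith.
  apply/eqP; rewrite addr_eq0 Z2_opp; apply/eqP; congr f; rewrite -!map_comp.
  by apply: eq_map_bounded wp => y yp /=; arith.
rewrite big_nat big1 // => j /andP[_ jp]; rewrite ifF //; arith.
Qed.

Lemma gaps_absorb p f w : bounded p w ->
  sum_along (gaps p) (sum_along (absorb_last p.+1) f) w = f w.
Proof.
move=> wp; rewrite !sum_alongE big_nat_recr //= big_nat big1 ?add0r.
  by rewrite sum_absorb_last eqxx expandK'.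
by move=> j /andP[_ jp]; rewrite sum_absorb_last eqSS ltn_eqF.
Qed.

(** Forgetting the first letter commutes with faces. The restriction [x <> 0]
    breaks this exactly when a face pushes [x] into block [0]: from the last block,
    or from the first one, which is the mirror image. *)
Lemma forget_inner_homotopy p f x w : bounded p.+1 (x :: w) ->
  sum_along (faces p.+1) (sum_along forget_inner f) (x :: w) +
  sum_along forget_inner (sum_along (faces p.+1) f) (x :: w) =
  sum_along (absorb_last p.+1) f (x :: w) +
  sum_along (mirror p.+1) (sum_along (absorb_last p.+1) (sum_along (mirror p) f)) (x :: w).
Proof.
rewrite bounded_cons => /andP[xp wp]; rewrite !sum_faces sum_forget_inner sum_absorb_last
  sum_mirror /=.
rewrite sum_absorb_last sum_mirror sum_faces;
  under eq_bigr => i _ do rewrite /= sum_forget_inner.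
have [->|x0] := eqVneq x 0%N.
  rewrite addr0 /flip /= addr0 big_nat big1 // => j /andP[_ jp]; rewrite ifT //; arith.
rewrite -big_split big_nat_recl // big_nat_recr //= [X in _ + (X + _)]big_nat.
rewrite [X in _ + (X + _)]big1 ?add0r; last first.
  move=> j /andP[_ jp]; rewrite ifF ?Z2_addxx //; arith.
rewrite addrC; congr (_ + _).
  have [->|xNp] := eqVneq x p.+1; first by rewrite ifT ?add0r //; arith.
  by rewrite ifF ?Z2_addxx //; arith.
have -> : map (flip p) (map (merge_blocks p.+1 p.+1) (map (flip p.+1) w)) =
  map (merge_blocks p.+1 0) w.
  by rewrite -!map_comp; apply: eq_map_bounded wp => y yp /=; arith.
have [->|xN1] := eqVneq x 1%N; first by rewrite !ifT ?add0r //; arith.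
by rewrite !ifF ?Z2_addxx //; arith.
Qed.

(** The telescoping end faces give [f (x :: w)] and [f (0 :: w)]; the sweep
    is cut short by the face that sends the last block to [0], and this produces
    the last summand. *)
Lemma sweep_homotopy p f x w : bounded p.+1 (x :: w) ->
  sum_along (faces p.+1) (sum_along sweep f) (x :: w) +
  sum_along sweep (sum_along (faces p.+2) f) (x :: w) =
  f (x :: w) + f (0%N :: w) + sum_along (absorb_last p.+1) (sum_along (gaps p) f) (x :: w).
Proof.
rewrite bounded_cons => /andP[xp wp]; rewrite !sum_alongE;
  under eq_bigr => i _ do rewrite /= sum_sweep.
under [X in _ + X]eq_bigr => i _ do rewrite sum_faces.
rewrite (@prism_sum p.+1 x (fun i j => f (map (merge_blocks p.+2 i) (j.+1 :: map (expand
  j) w)))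
  (fun i j => f (j.+1 :: map (expand j) (map (merge_blocks p.+1 i) w)))) //; last 3 first.
- exact: leqW.
- move=> i j ij; congr f => /=; congr (_ :: _); first by arith.
  by rewrite -!map_comp; apply: eq_map_bounded wp => y /=; apply: merge_expand_lt; lia.
- move=> i j jp ij; congr f => /=; congr (_ :: _); first by arith.
  by rewrite -!map_comp; apply: eq_map_bounded wp => y /=; apply: merge_expand_gt.
rewrite addrCA.
have -> : \sum_(0 <= j < x) (f (map (merge_blocks p.+2 j) (j.+1 :: map (expand j) w)) +
     f (map (merge_blocks p.+2 j.+1) (j.+1 :: map (expand j) w))) =
       f (x :: w) + f (0%N :: w).
  rewrite addrC -(telescope_sum (fun j => f (j :: w))); apply: eq_big_nat => j /andP[_ jx].
  rewrite /= expandK // expandK' //; last by lia.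
  by congr (f (_ :: _) + f (_ :: _)); arith.
congr (_ + _); rewrite -big_split big_nat_recr //= big_nat big1 ?add0r; last first.
  move=> i /andP[_ ip].
  have -> : merge_blocks p.+1 i x = (if i < x then x.-1 else x)%N by arith.
  exact: Z2_addxx.
have [->|xNp] := eqVneq x p.+1.
  by rewrite ltnn /merge_blocks !eqxx /= big_geq // add0r.
rewrite ltnNge xp /=; have -> : merge_blocks p.+1 p.+1 x = x by arith.
exact: Z2_addxx.
Qed.

(** A sweep and its mirror image together go once around the whole circle. *)
Lemma sweep_mirror p f x w : bounded p (x :: w) ->
  sum_along (mirror p) (sum_along sweep f) (x :: w) +
  sum_along sweep (sum_along (mirror p.+1) f) (x :: w) =
  sum_along forget_inner (sum_along (mirror p) (sum_along (gaps p) f)) (x :: w).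
Proof.
rewrite bounded_cons => /andP[xp wp]; rewrite sum_forget_inner !sum_mirror sum_gaps /=
  !sum_sweep.
have [->|x0] := eqVneq x 0%N; first by rewrite !big_geq // addr0.
have -> : flip p x = (p.+1 - x)%N by arith.
rewrite (big_cat_nat (n := (p.+1 - x)%N) (p := p.+1)) //=; last by lia.
congr (_ + _); rewrite -[X in _ = \big[_/_]_(X <= _ < _) _]add0n big_addn subKn;
  last by lia.
rewrite [RHS]big_nat_rev; apply: eq_big_nat => j /andP[_ jx].
rewrite sum_mirror; congr f => /=; congr (_ :: _); first by arith.
by rewrite -!map_comp; apply: eq_map_bounded wp => y yp /=; arith.
Qed.
End Identities.

(** * Normalised cochains *)

Definition word_shape n p (w : seq nat) : bool := (size w == n) && bounded p w.

(** Blocks other than block [0] must not be empty; block [0] never is, for it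
    contains the largest element of the ground set, which is not a letter position. *)
Definition onto p (w : seq nat) : bool := all (mem w) (iota 1 p).

Lemma ontoPn p w : reflect (exists2 y, 0 < y <= p & y \notin w) (~~ onto p w).
Proof.
apply: (iffP allPn) => -[y].
  by rewrite mem_iota add1n ltnS => yp yw; exists y.
by move=> yp yw; exists y => //; rewrite mem_iota add1n ltnS.
Qed.

Definition words n p : seq (seq nat) :=
  [seq w <- [seq [seq val i | i <- tval t] | t : n.-tuple 'I_p.+1] | onto p w].

Lemma mem_words n p w : (w \in words n p) = word_shape n p w && onto p w.
Proof.
rewrite mem_filter andbC; congr (_ && _); apply/imageP/andP => [[t _ ->]|[/eqP wn wp]].
  rewrite size_map size_tuple eqxx; split=> //.
  by apply/allP=> _ /mapP[i _ ->]; rewrite -ltnS; apply: ltn_ord.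
have sw : size (map (@inord p) w) == n by rewrite size_map wn.
exists (Tuple sw) => //=; rewrite -map_comp -[LHS]map_id.
by apply: eq_map_bounded wp => x xp /=; rewrite inordK.
Qed.

Definition cochain n p : Type := {ffun seq_sub (words n p) -> 'Z_2}.
HB.instance Definition _ n p := GRing.Zmodule.on (cochain n p).

Section Cochains.
Local Open Scope ring_scope.

(** Extension by zero: functions on nondegenerate words are treated as
    normalised simplicial cochains. *)
Definition ev n p (u : cochain n p) (w : seq nat) : 'Z_2 := oapp u 0 (insub w).

Lemma ev_val n p (u : cochain n p) (w : seq_sub (words n p)) : ev u (val w) = u w.
Proof. by rewrite /ev valK. Qed.

Lemma ev_out n p (u : cochain n p) w : w \notin words n p -> ev u w = 0.
Proof. by move=> wN; rewrite /ev insubN. Qed.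

Lemma ev_degenerate n p (u : cochain n p) w : ~~ onto p w -> ev u w = 0.
Proof. by move=> wN; rewrite ev_out // mem_words (negPf wN) andbF. Qed.

Lemma cochainP n p (u v : cochain n p) :
  (forall w, word_shape n p w -> onto p w -> ev u w = ev v w) -> u = v.
Proof.
move=> uv; apply/ffunP=> w; rewrite -!ev_val.
by have := valP w; rewrite mem_words => /andP[]; apply: uv.
Qed.

Lemma evD n p (u v : cochain n p) w : ev (u + v) w = ev u w + ev v w.
Proof. by rewrite /ev; case: insub => [x|] /=; rewrite ?addr0 ?ffunE. Qed.

Lemma ev0 n p w : ev (0 : cochain n p) w = 0.
Proof. by rewrite /ev; case: insub => [x|] //=; rewrite ffunE. Qed.

Definition pull n p m q (k : seq nat -> seq (seq nat)) (u : cochain n p) : cochain m q :=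
  [ffun w => sum_along k (ev u) (val w)].

Lemma pullD n p m q k : {morph @pull n p m q k : u v / u + v}.
Proof.
move=> u v; apply/ffunP=> w; rewrite !ffunE /sum_along -big_split.
by apply: eq_bigr => x _; rewrite evD.
Qed.

(** The second condition lets [pull k] be evaluated on degenerate words too, so
    that identities between formal sums can be proved on all bounded words. *)
Definition natural n p m q (k : seq nat -> seq (seq nat)) : Prop :=
  forall w, word_shape m q w -> {in k w, forall v, word_shape n p v} /\
    (~~ onto q w -> forall u : cochain n p, sum_along k (ev u) w = 0).

Lemma degenerate_natural n p m q k :
    (forall w, word_shape m q w -> {in k w, forall v, word_shape n p v}) ->
    (forall w y, word_shape m q w -> (0 < y <= q)%N -> y \notin w ->
       {in k w, forall v, ~~ onto p v}) ->
  natural n p m q k.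
Proof.
move=> kshape kdeg w wq; split; first exact: kshape.
case/ontoPn=> y yq yw u; rewrite /sum_along big_seq big1 // => v.
by move/(kdeg _ _ wq yq yw)/ev_degenerate.
Qed.

Lemma ev_pull n p m q k (u : cochain n p) w : natural n p m q k -> word_shape m q w ->
  ev (@pull n p m q k u) w = sum_along k (ev u) w.
Proof.
move=> kP wq; have [wo|wd] := boolP (onto q w); last first.
  by rewrite ev_degenerate // (kP w wq).2.
have ww : w \in words m q by rewrite mem_words wq.
by rewrite /ev insubT /= ffunE.
Qed.

Lemma ev_pull2 n p m q l r j k (u : cochain n p) w :
    natural n p m q j -> natural m q l r k -> word_shape l r w ->
  ev (@pull m q l r k (@pull n p m q j u)) w = sum_along k (sum_along j (ev u)) w.
Proof.
move=> jP kP wr; rewrite ev_pull // /sum_along big_seq [RHS]big_seq.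
by apply: eq_bigr => v vw; rewrite ev_pull //; apply: (kP w wr).1.
Qed.

Lemma word_shape_cons n p x w : word_shape n.+1 p (x :: w) = (x <= p)%N && word_shape n p w.
Proof. by rewrite /word_shape /= eqSS andbCA. Qed.

Lemma word_shape_map n p q (f : nat -> nat) w :
  (forall x, (x <= p)%N -> (f x <= q)%N) -> word_shape n p w -> word_shape n q (map f w).
Proof. by move=> fpq /andP[wn wp]; rewrite /word_shape size_map wn;
  apply: bounded_map wp. Qed.

Lemma notin_map (f : nat -> nat) p y w :
  (forall x, (x <= p)%N -> f x = f y -> x = y) -> bounded p w -> y \notin w ->
  f y \notin map f w.
Proof.
move=> fy /allP wp yw; apply/mapP=> -[x xw fyx].
by move: yw; rewrite -(fy x) ?xw //; apply: wp.
Qed.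

(** If a block is empty, then its merging with either neighbour gives the same
    word; these two terms cancel mod 2, and all others remain degenerate. *)
Lemma natural_faces n p : natural n p n p.+1 (faces p.+1).
Proof.
move=> w wp; split.
  move=> v /mapP[j]; rewrite mem_index_iota => jp ->.
  by apply: word_shape_map wp => x xp; arith.
case/ontoPn=> [[//|y] /= yp yw] u; rewrite sum_faces.
have wb := andP wp; have degj j : (j <= p.+1)%N -> j != y -> j != y.+1 ->
    ev u (map (merge_blocks p.+1 j) w) = 0.
  move=> jp jy jy1; apply: ev_degenerate; apply/ontoPn.
  exists (merge_blocks p.+1 j y.+1); first by arith.
  by apply: (@notin_map _ p.+1) wb.2 yw => x xp; arith.
rewrite (big_cat_nat (n := y)) ?leqW //= big_nat big1 ?add0r; last first.
  by move=> j /andP[_ jy]; apply: degj; lia.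
have y2 : (y < p.+2)%N by lia.
rewrite big_ltn // big_ltn // big_nat big1 ?addr0; last first.
  by move=> j /andP[jy jp]; apply: degj; lia.
apply/eqP; rewrite addr_eq0 Z2_opp; apply/eqP; congr ev.
apply/eq_in_map=> x xw; have xp : (x <= p.+1)%N := allP wb.2 x xw.
have xy : x != y.+1 by apply: contraNneq yw => <-.
arith.
Qed.

Lemma natural_mirror n p : natural n p n p (mirror p).
Proof.
apply: degenerate_natural => [w wp v|w y wp yp yw v]; rewrite inE => /eqP->.
  by apply: word_shape_map wp => x xp; arith.
apply/ontoPn; exists (flip p y); first by arith.
by apply: (@notin_map _ p) yw => [x xp|]; [arith | case/andP: wp].
Qed.

Lemma degenerate_expand p j y v :
  (0 < y <= p)%N -> bounded p v -> y \notin v -> ~~ onto p.+1 (j.+1 :: map (expand j) v).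
Proof.
move=> yp vp yv; apply/ontoPn; exists (expand j y); first by arith.
rewrite inE negb_or; apply/andP; split; first by arith.
by apply: (@notin_map _ p) vp yv => x xp; arith.
Qed.

Lemma natural_gaps n p : natural n.+1 p.+1 n p (gaps p).
Proof.
apply: degenerate_natural => [w wp v|w y wp yp yw v] /mapP[j];
    rewrite mem_index_iota => jp ->.
  rewrite word_shape_cons (jp : (j < p.+1)%N); apply: word_shape_map wp => x xp; arith.
by apply: degenerate_expand yp _ yw; case/andP: wp.
Qed.

Lemma natural_in_base n p : natural n.+1 p n p in_base.
Proof.
apply: degenerate_natural => [w wp v|w y wp yp yw v]; rewrite inE => /eqP->.
  by rewrite word_shape_cons.
by apply/ontoPn; exists y => //; rewrite inE negb_or yw andbT; lia.
Qed.

Lemma natural_forget n p : natural n p n.+1 p forget.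
Proof.
apply: degenerate_natural => [[//|x w]|[//|x w] y]; rewrite word_shape_cons => /andP[xp wp].
  by move=> v; rewrite inE => /eqP->.
move=> yp; rewrite inE negb_or => /andP[_ yw] v; rewrite inE => /eqP->.
by apply/ontoPn; exists y.
Qed.

Lemma natural_forget_inner n p : natural n p n.+1 p forget_inner.
Proof.
apply: degenerate_natural => [[//|x w]|[//|x w] y]; rewrite word_shape_cons => /andP[xp wp].
  by move=> v /=; case: eqP => _ //; rewrite inE => /eqP->.
move=> yp; rewrite inE negb_or => /andP[_ yw] v /=.
by case: eqP => _ //; rewrite inE => /eqP->; apply/ontoPn; exists y.
Qed.

Lemma natural_absorb n p : natural n p n.+1 p.+1 (absorb_last p.+1).
Proof.
apply: degenerate_natural => [[//|x w]|[//|x w] y]; rewrite word_shape_cons => /andP[xp wp].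
  move=> v /=; case: eqP => _ //; rewrite inE => /eqP->.
  by apply: word_shape_map wp => z zp; arith.
move=> yp; rewrite inE negb_or => /andP[yx yw] v /=.
case: eqP => xE //; rewrite inE => /eqP->; apply/ontoPn; exists y; first by lia.
apply/mapP=> -[z zw]; have zp := allP (andP wp).2 z zw.
have zy : z != y by apply: contraNneq yw => <-.
by arith.
Qed.

Lemma natural_sweep n p : natural n.+1 p.+1 n.+1 p sweep.
Proof.
apply: degenerate_natural => [[//|x w]|[//|x w] y]; rewrite word_shape_cons => /andP[xp wp].
  move=> v /mapP[j]; rewrite mem_index_iota => jx ->.
  rewrite word_shape_cons (leqW (leq_trans (jx : (j < x)%N) xp)) /=.
  by apply: word_shape_map wp => z zp; arith.
move=> yp; rewrite inE negb_or => /andP[_ yw] v /mapP[j _ ->].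
by apply: degenerate_expand yp _ yw; case/andP: wp.
Qed.
End Cochains.

(** * Operators on cochains *)

Section Operators.
Local Open Scope ring_scope.

Definition coboundary n p : cochain n p -> cochain n p.+1 := @pull n p n p.+1 (faces p.+1).
Definition reverse n p : cochain n p -> cochain n p := @pull n p n p (mirror p).

(** The reversal-invariant functions are the image of this map, when reversal
    has no fixed point. *)
Definition norm n p (u : cochain n p) : cochain n p := u + reverse u.

(** Integration along the fibre of the map that forgets the first letter, a
    map between tori whose fibre is a circle. *)
Definition push n p : cochain n.+1 p.+1 -> cochain n p := @pull n.+1 p.+1 n p (gaps p).

(** Restriction to the zero section of the same map. *)
Definition restrict n p : cochain n.+1 p -> cochain n p := @pull n.+1 p n p in_base.
Definition extend n p : cochain n p -> cochain n.+1 p := @pull n p n.+1 p forget.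
Definition extend_inner n p : cochain n p -> cochain n.+1 p :=
  @pull n p n.+1 p forget_inner.
Definition suspend n p : cochain n p -> cochain n.+1 p.+1 :=
  @pull n p n.+1 p.+1 (absorb_last p.+1).
Definition slide n p : cochain n.+1 p.+1 -> cochain n.+1 p :=
  @pull n.+1 p.+1 n.+1 p sweep.

(** Reversal exchanges blocks [1] and [p], so the order in which their first
    elements occur selects one word in each pair of mirror images. *)
Definition orient n p (u : cochain n p) : cochain n p :=
  [ffun w => if (index 1%N (val w) < index p (val w))%N then u w else 0].

Lemma cochain_addxx n p (u : cochain n p) : u + u = 0.
Proof. by apply/ffunP=> w; rewrite !ffunE Z2_addxx. Qed.

Lemma cochain_addK n p (u v : cochain n p) : u + (u + v) = v.
Proof. by rewrite addrA cochain_addxx add0r. Qed.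

Lemma pull0 n p m q k : @pull n p m q k 0 = 0.
Proof. by rewrite -[X in pull m q k X](cochain_addxx 0) pullD cochain_addxx. Qed.

Lemma coboundaryD n p : {morph @coboundary n p : u v / u + v}.
Proof. exact: pullD. Qed.

Lemma coboundary0 n p : @coboundary n p 0 = 0.
Proof. exact: pull0. Qed.

Lemma reverseD n p : {morph @reverse n p : u v / u + v}.
Proof. exact: pullD. Qed.

Lemma reverse0 n p : @reverse n p 0 = 0.
Proof. exact: pull0. Qed.

Lemma pushD n p : {morph @push n p : u v / u + v}.
Proof. exact: pullD. Qed.

Lemma push0 n p : @push n p 0 = 0.
Proof. exact: pull0. Qed.

Lemma restrictD n p : {morph @restrict n p : u v / u + v}.
Proof. exact: pullD. Qed.

Lemma restrict0 n p : @restrict n p 0 = 0.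
Proof. exact: pull0. Qed.

Lemma extendD n p : {morph @extend n p : u v / u + v}.
Proof. exact: pullD. Qed.

Lemma extend0 n p : @extend n p 0 = 0.
Proof. exact: pull0. Qed.

Lemma extend_innerD n p : {morph @extend_inner n p : u v / u + v}.
Proof. exact: pullD. Qed.

Lemma extend_inner0 n p : @extend_inner n p 0 = 0.
Proof. exact: pull0. Qed.

Lemma suspendD n p : {morph @suspend n p : u v / u + v}.
Proof. exact: pullD. Qed.

Lemma suspend0 n p : @suspend n p 0 = 0.
Proof. exact: pull0. Qed.

Lemma slideD n p : {morph @slide n p : u v / u + v}.
Proof. exact: pullD. Qed.

Lemma slide0 n p : @slide n p 0 = 0.
Proof. exact: pull0. Qed.

Lemma normD n p : {morph @norm n p : u v / u + v}.
Proof. by move=> u v; rewrite /norm reverseD addrACA. Qed.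

Lemma norm0 n p : norm (0 : cochain n p) = 0.
Proof. by rewrite /norm reverse0 addr0. Qed.

Lemma coboundaryK n p (u : cochain n p.+1) : coboundary (coboundary u) = 0.
Proof.
apply: cochainP => w wp _; rewrite ev0 (ev_pull2 _ (@natural_faces _ _) (@natural_faces _
  _)) //.
by apply: faces_faces; case/andP: wp.
Qed.

Lemma coboundary_reverse n p (u : cochain n p) :
  coboundary (reverse u) = reverse (coboundary u).
Proof.
apply: cochainP => w wp _.
rewrite (ev_pull2 _ (@natural_mirror _ _) (@natural_faces _ _)) //.
rewrite (ev_pull2 _ (@natural_faces _ _) (@natural_mirror _ _)) //.
by apply: faces_mirror; case/andP: wp.
Qed.

Lemma reverseK n p (u : cochain n p) : reverse (reverse u) = u.
Proof.
apply: cochainP => w wp _; rewrite (ev_pull2 _ (@natural_mirror _ _) (@natural_mirror _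
  _)) //.
rewrite !sum_alongE -map_comp -[in RHS](map_id w); congr (ev u); case/andP: wp => _.
by apply: eq_map_bounded => x xp /=; arith.
Qed.

Lemma reverse1 n (u : cochain n 1) : reverse u = u.
Proof.
apply: cochainP => w wp _; rewrite (ev_pull _ (@natural_mirror _ _)) // sum_mirror.
rewrite -[in RHS](map_id w); congr (ev u); case/andP: wp => _.
by apply: eq_map_bounded => x xp /=; arith.
Qed.

Lemma push_coboundary n p (u : cochain n.+1 p.+1) :
  push (coboundary u) = coboundary (push u).
Proof.
apply: cochainP => w wp _.
rewrite (ev_pull2 _ (@natural_faces _ _) (@natural_gaps _ _)) //.
rewrite (ev_pull2 _ (@natural_gaps _ _) (@natural_faces _ _)) //.
by apply: gaps_faces; case/andP: wp.
Qed.

Lemma push_reverse n p (u : cochain n.+1 p.+1) : push (reverse u) = reverse (push u).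
Proof.
apply: cochainP => w wp _.
rewrite (ev_pull2 _ (@natural_mirror _ _) (@natural_gaps _ _)) //.
rewrite (ev_pull2 _ (@natural_gaps _ _) (@natural_mirror _ _)) //.
by apply: gaps_mirror; case/andP: wp.
Qed.

Lemma restrict_coboundary n p (u : cochain n.+1 p) :
  restrict (coboundary u) = coboundary (restrict u).
Proof.
apply: cochainP => w wp _.
rewrite (ev_pull2 _ (@natural_faces _ _) (@natural_in_base _ _)) //.
rewrite (ev_pull2 _ (@natural_in_base _ _) (@natural_faces _ _)) //.
rewrite !sum_alongE; apply: eq_big_nat => j /andP[_ jp]; rewrite sum_alongE /=.
by congr (ev u (_ :: _)); arith.
Qed.

Lemma restrict_reverse n p (u : cochain n.+1 p) :
  restrict (reverse u) = reverse (restrict u).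
Proof.
apply: cochainP => w wp _.
rewrite (ev_pull2 _ (@natural_mirror _ _) (@natural_in_base _ _)) //.
by rewrite (ev_pull2 _ (@natural_in_base _ _) (@natural_mirror _ _)) // !sum_alongE.
Qed.

Lemma extend_coboundary n p (v : cochain n p) :
  extend (coboundary v) = coboundary (extend v).
Proof.
apply: cochainP => -[//|x w] xwp _; have := xwp; rewrite word_shape_cons => /andP[xp wp].
rewrite (ev_pull2 _ (@natural_faces _ _) (@natural_forget _ _)) //.
rewrite (ev_pull2 _ (@natural_forget _ _) (@natural_faces _ _)) //.
by rewrite !sum_alongE; apply: eq_big_nat => j _; rewrite sum_alongE.
Qed.

Lemma extend_reverse n p (v : cochain n p) : extend (reverse v) = reverse (extend v).
Proof.
apply: cochainP => -[//|x w] xwp _.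
rewrite (ev_pull2 _ (@natural_mirror _ _) (@natural_forget _ _)) //.
by rewrite (ev_pull2 _ (@natural_forget _ _) (@natural_mirror _ _)) // !sum_alongE.
Qed.

Lemma extend_inner_reverse n p (v : cochain n p) :
  extend_inner (reverse v) = reverse (extend_inner v).
Proof.
apply: cochainP => -[//|x w] xwp _; have := xwp; rewrite word_shape_cons => /andP[xp wp].
rewrite (ev_pull2 _ (@natural_mirror _ _) (@natural_forget_inner _ _)) //.
rewrite (ev_pull2 _ (@natural_forget_inner _ _) (@natural_mirror _ _)) //.
rewrite sum_forget_inner !sum_mirror sum_forget_inner.
by have -> : (flip p x == 0%N) = (x == 0%N) by arith.
Qed.

Lemma restrict_extend n p (v : cochain n p) : restrict (extend v) = v.
Proof.
apply: cochainP => w wp _.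
by rewrite (ev_pull2 _ (@natural_forget _ _) (@natural_in_base _ _)) // !sum_alongE.
Qed.

Lemma restrict_extend_inner n p (v : cochain n p) : restrict (extend_inner v) = 0.
Proof.
apply: cochainP => w wp _; rewrite ev0.
by rewrite (ev_pull2 _ (@natural_forget_inner _ _) (@natural_in_base _ _)) // !sum_alongE.
Qed.

Lemma restrict_suspend n p (v : cochain n p) : restrict (suspend v) = 0.
Proof.
apply: cochainP => w wp _; rewrite ev0.
by rewrite (ev_pull2 _ (@natural_absorb _ _) (@natural_in_base _ _)) // !sum_alongE.
Qed.

Lemma ev_expand n p (v : cochain n p.+1) j w : word_shape n p w -> (j <= p)%N ->
  ev v (map (expand j) w) = 0.
Proof.
move=> wp jp; apply: ev_degenerate; apply/ontoPn; exists j.+1 => //.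
by apply/mapP=> -[x _]; arith.
Qed.

Lemma push_extend n p (v : cochain n p.+1) : push (extend v) = 0.
Proof.
apply: cochainP => w wp _; rewrite ev0.
rewrite (ev_pull2 _ (@natural_forget _ _) (@natural_gaps _ _)) // sum_alongE big_nat big1
  // => j.
by move=> /andP[_ jp]; rewrite sum_alongE (ev_expand _ wp).
Qed.

Lemma push_extend_inner n p (v : cochain n p.+1) : push (extend_inner v) = 0.
Proof.
apply: cochainP => w wp _; rewrite ev0.
rewrite (ev_pull2 _ (@natural_forget_inner _ _) (@natural_gaps _ _)) // sum_alongE.
rewrite big_nat big1 // => j.
by move=> /andP[_ jp]; rewrite sum_alongE (ev_expand _ wp).
Qed.

Lemma push_suspend n p (v : cochain n p) : push (suspend v) = v.
Proof.
apply: cochainP => w wp _.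
rewrite (ev_pull2 _ (@natural_absorb _ _) (@natural_gaps _ _)) //.
by apply: gaps_absorb; case/andP: wp.
Qed.

Lemma coboundary_suspend n p (v : cochain n p) :
  coboundary (suspend v) = suspend (coboundary v).
Proof.
apply: cochainP => -[//|x w] xwp _.
rewrite (ev_pull2 _ (@natural_absorb _ _) (@natural_faces _ _)) //.
rewrite (ev_pull2 _ (@natural_faces _ _) (@natural_absorb _ _)) //.
by apply: absorb_faces; case/andP: xwp.
Qed.

(** The cochain map [suspend] is not compatible with reversal, but it is
    homotopic to its conjugate, through a homotopy that is compatible. *)
Lemma coboundary_extend_inner n p (v : cochain n p) :
  coboundary (extend_inner v) =
  extend_inner (coboundary v) + suspend v + reverse (suspend (reverse v)).
Proof.
apply: cochainP => -[//|x w] xwp _.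
have wS := @natural_absorb n p.
apply: Z2_eq; rewrite !evD -!addrA [LHS]addrA.
rewrite (ev_pull2 _ (@natural_forget_inner _ _) (@natural_faces _ _)) //.
rewrite (ev_pull2 _ (@natural_faces _ _) (@natural_forget_inner _ _)) //.
rewrite [in X in _ + X](ev_pull _ wS) // [ev (reverse _) _](ev_pull _ (@natural_mirror _
  _)) //.
rewrite forget_inner_homotopy; last by case/andP: xwp.
rewrite !sum_mirror (ev_pull2 _ (@natural_mirror _ _) wS); first exact: Z2_addxx.
by apply: word_shape_map xwp => y yp; arith.
Qed.

(** Up to the homotopy [slide], a cochain is the sum of a part pulled back from
    the base and a part recovered from its integral along the fibre. *)
Lemma coboundary_slide n p (u : cochain n.+1 p.+1) :
  coboundary (slide u) =
  slide (coboundary u) + (u + extend (restrict u)) + suspend (push u).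
Proof.
apply: cochainP => -[//|x w] xwp _.
apply: Z2_eq; rewrite !evD -!addrA [LHS]addrA.
rewrite (ev_pull2 _ (@natural_sweep _ _) (@natural_faces _ _)) //.
rewrite (ev_pull2 _ (@natural_faces _ _) (@natural_sweep _ _)) //.
rewrite (ev_pull2 _ (@natural_gaps _ _) (@natural_absorb _ _)) //.
rewrite (ev_pull2 _ (@natural_in_base _ _) (@natural_forget _ _)) //.
rewrite sweep_homotopy; last by case/andP: xwp.
by rewrite sum_forget sum_in_base [X in _ + X]addrA Z2_addxx.
Qed.

Lemma slide_reverse n p (u : cochain n.+1 p.+1) :
  slide (reverse u) = reverse (slide u) + extend_inner (reverse (push u)).
Proof.
apply: cochainP => -[//|x w] xwp _; have := xwp; rewrite word_shape_cons => /andP[xp wp].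
apply: Z2_eq; rewrite !evD addrA [X in X + _]addrC.
rewrite (ev_pull2 _ (@natural_mirror _ _) (@natural_sweep _ _)) //.
rewrite (ev_pull2 _ (@natural_sweep _ _) (@natural_mirror _ _)) //.
rewrite sweep_mirror; last by case/andP: xwp.
rewrite (ev_pull _ (@natural_forget_inner _ _)) // !sum_forget_inner.
case: ifP => _; first exact: addr0.
by rewrite (ev_pull2 _ (@natural_gaps _ _) (@natural_mirror _ _)) // Z2_addxx.
Qed.

Lemma index_flip p y w : bounded p w -> (0 < y <= p)%N ->
  index y (map (flip p) w) = index (flip p y) w.
Proof.
move=> /allP wp yp; rewrite /index find_map; apply: eq_in_find => x /wp xp /=.
by apply/eqP/eqP; arith.
Qed.

(** Reversal is free on words with at least two blocks besides block [0]. *)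
Lemma norm_orient n p (u : cochain n p.+2) : norm u = 0 -> norm (orient u) = u.
Proof.
move=> Nu; apply: cochainP => w wp wo; have wb := andP wp.
have fwp : word_shape n p.+2 (map (flip p.+2) w) by apply: word_shape_map wp => x xp; arith.
have evO v : v \in words n p.+2 ->
    ev (orient u) v = if (index 1%N v < index p.+2 v)%N then ev u v else 0.
  by move=> vw; rewrite /ev insubT /= ffunE.
have inw (v : seq nat) : word_shape n p.+2 v -> onto p.+2 v -> v \in words n p.+2.
  by move=> *; rewrite mem_words; apply/andP.
have fwo : onto p.+2 (map (flip p.+2) w).
  apply: contraTT wo => /ontoPn[y yp yw]; apply/ontoPn; exists (flip p.+2 y);
    first by arith.
  apply: contra yw => yw; apply/mapP; exists (flip p.+2 y) => //; arith.
have uflip : ev u (map (flip p.+2) w) = ev u w.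
  have := congr1 (fun v => ev v w) Nu; rewrite /norm evD ev0 (ev_pull _ (@natural_mirror
    _ _)) //.
  by rewrite sum_mirror => /Z2_eq.
rewrite /norm evD (ev_pull _ (@natural_mirror _ _)) // sum_mirror !evO ?inw // uflip.
rewrite !index_flip ?wb.2 //; last by lia.
have -> : flip p.+2 1 = p.+2 by arith.
have -> : flip p.+2 p.+2 = 1%N by arith.
have [w1 w2] : 1%N \in w /\ p.+2 \in w.
  by split; apply: (allP wo); rewrite mem_iota; lia.
case: ltngtP => [_|_|eq12]; rewrite ?addr0 ?add0r //.
by have := nth_index 0%N w1; rewrite eq12 nth_index.
Qed.

Lemma normK n p (u : cochain n p) : norm (norm u) = 0.
Proof.
by rewrite /norm reverseD reverseK [reverse u + u]addrC cochain_addxx.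
Qed.

Lemma norm1 n (u : cochain n 1) : norm u = 0.
Proof. by rewrite /norm reverse1 cochain_addxx. Qed.

Lemma norm_coboundary n p (u : cochain n p) : norm (coboundary u) = coboundary (norm u).
Proof. by rewrite /norm -coboundary_reverse coboundaryD. Qed.

Lemma norm_push n p (u : cochain n.+1 p.+1) : norm (push u) = push (norm u).
Proof. by rewrite /norm -push_reverse pushD. Qed.

Lemma norm_restrict n p (u : cochain n.+1 p) : norm (restrict u) = restrict (norm u).
Proof. by rewrite /norm -restrict_reverse restrictD. Qed.

Lemma norm_extend n p (u : cochain n p) : norm (extend u) = extend (norm u).
Proof. by rewrite /norm -extend_reverse extendD. Qed.

Lemma norm_extend_inner n p (u : cochain n p) :
  norm (extend_inner u) = extend_inner (norm u).
Proof. by rewrite /norm -extend_inner_reverse extend_innerD. Qed.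
End Operators.

(** * Reversal-invariant cohomology and its recurrence *)

Section Homology.
Local Open Scope ring_scope.

(** The function [norm u] stands for a chain of the quotient complex, and
    [norm] commutes with [coboundary]. *)
Definition is_cocycle n p (u : cochain n p) : Prop := norm (coboundary u) = 0.

(** For [p = 1] reversal is the identity and [norm] vanishes. The right object
    is then the space of all functions, without any quotient: this is what the
    integral along the fibre takes values in when [p = 2]. *)
Definition is_trivial n p : cochain n p -> Prop :=
  match p return cochain n p -> Prop with
  | q.+2 => fun u => exists v : cochain n q.+1, norm u = norm (coboundary v)
  | _ => fun u => u = 0
  end.

(** Over the field with two elements, an additive map that is onto and has the
    trivial cocycles as kernel identifies the cohomology with row vectors. *)
Definition betti n p k : Prop :=
  exists phi : cochain n p -> 'rV['Z_2]_k,
    [/\ {morph phi : u v / u + v},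
        forall u, is_cocycle u -> (phi u = 0 <-> is_trivial u)
      & forall t, exists2 u, is_cocycle u & phi u = t].

Lemma cocycle_push n p (u : cochain n.+1 p.+1) : is_cocycle u -> is_cocycle (push u).
Proof. by rewrite /is_cocycle => Nu; rewrite -push_coboundary norm_push Nu push0. Qed.

Lemma cocycle_restrict n p (u : cochain n.+1 p) : is_cocycle u -> is_cocycle (restrict u).
Proof.
by rewrite /is_cocycle => Nu; rewrite -restrict_coboundary norm_restrict Nu restrict0.
Qed.

Lemma cocycle_extend n p (v : cochain n p) : is_cocycle v -> is_cocycle (extend v).
Proof. by rewrite /is_cocycle => Nv; rewrite -extend_coboundary norm_extend Nv extend0. Qed.

Lemma cocycleD n p (u v : cochain n p) : is_cocycle u -> is_cocycle v -> is_cocycle (u + v).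
Proof. by rewrite /is_cocycle coboundaryD normD => -> ->; rewrite addr0. Qed.

(** The section [suspend v] of [push] is corrected by a homotopy, for which a
    non-invariant primitive [orient (coboundary v)] of [coboundary v] under [norm]
    is chosen. *)
Definition cocycle_lift n p (v : cochain n p.+1) : cochain n.+1 p.+2 :=
  suspend v + extend_inner (orient (coboundary v)).

Lemma cocycle_lift_cocycle n p (v : cochain n p.+1) : is_cocycle v ->
  is_cocycle (cocycle_lift v).
Proof.
rewrite /is_cocycle /cocycle_lift => cv; set e := orient _.
have Ne : norm e = coboundary v by apply: norm_orient.
have -> : coboundary (suspend v + extend_inner e) =
    norm (suspend (reverse e)) + extend_inner (coboundary e).
  rewrite coboundaryD coboundary_suspend coboundary_extend_inner.
  rewrite -Ne /norm suspendD [suspend e + _]addrC -!addrA.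
  by congr (_ + _); rewrite [X in _ + X]addrCA cochain_addK addrC.
by rewrite normD normK add0r norm_extend_inner norm_coboundary Ne coboundaryK extend_inner0.
Qed.

Lemma push_cocycle_lift n p (v : cochain n p.+1) : push (cocycle_lift v) = v.
Proof. by rewrite pushD push_suspend push_extend_inner addr0. Qed.

Lemma restrict_cocycle_lift n p (v : cochain n p.+1) : restrict (cocycle_lift v) = 0.
Proof. by rewrite restrictD restrict_suspend restrict_extend_inner addr0. Qed.

Lemma trivial_push n p (u : cochain n.+1 p.+2) : is_trivial u -> is_trivial (push u).
Proof.
case: p u => [|p] u [w Nu] /=.
  rewrite -[u]norm_orient; first by rewrite -norm_push norm1.
  by rewrite Nu norm_coboundary norm1 coboundary0.
by exists (push w); rewrite norm_push Nu -norm_push push_coboundary.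
Qed.

Lemma trivial_restrict n p (u : cochain n.+1 p.+2) : is_trivial u ->
  is_trivial (restrict u).
Proof.
by case=> w Nu; exists (restrict w); rewrite norm_restrict Nu -norm_restrict
  restrict_coboundary.
Qed.

(** A primitive of [push u], lifted by [suspend], reduces the problem to the case
    [push u = 0]. *)
Lemma trivial_lift n p (u : cochain n.+1 p.+2) : is_trivial (push u) ->
  exists (w : cochain n.+1 p.+1) x, push u = push (coboundary w + norm x).
Proof.
case: p u => [|p] u /= => [pu0|[v Nv]].
  by exists 0, 0; rewrite pu0 norm0 coboundary0 addr0 push0.
set z := push u + coboundary v.
have Nz : norm z = 0 by rewrite normD Nv cochain_addxx.
exists (suspend v), (suspend (orient z)).
rewrite pushD push_coboundary -norm_push !push_suspend.
by rewrite norm_orient // /z addrC -addrA cochain_addxx addr0.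
Qed.

(** After a correction that kills the integral along the fibre, [slide] commutes
    with reversal, and the homotopy formula leaves only the restriction to the zero
    section. *)
Lemma trivial_of_fibre n p (u : cochain n.+1 p.+2) : is_cocycle u ->
  is_trivial (push u) -> is_trivial (restrict u) -> is_trivial u.
Proof.
move=> cu /trivial_lift[w [x puE]] [y Ey].
pose u' := u + (coboundary w + norm x).
have pu' : push u' = 0 by rewrite pushD puE cochain_addxx.
have cu' : is_cocycle u'.
  rewrite /is_cocycle /u' 2!coboundaryD coboundaryK -norm_coboundary add0r.
  by rewrite normD normK cu addr0.
have Nu' : norm u' = norm u + norm (coboundary w) by rewrite /u' 2!normD normK addr0.
clearbody u'.
have Hu' := coboundary_slide u'; rewrite pu' suspend0 addr0 in Hu'.
have NHD : norm (slide (coboundary u')) = 0.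
  have := slide_reverse (coboundary u').
  rewrite push_coboundary pu' coboundary0 reverse0 extend_inner0 addr0 => HR.
  by rewrite /norm -HR -slideD -/(norm _) cu' slide0.
(* The homotopy formula for [u'] has the primitive [slide u'] and the part pulled
   back from the zero section; up to [norm], [u'] differs from [u] by
   [coboundary w]. *)
exists (slide u' + extend (y + restrict w) + w).
rewrite !coboundaryD !normD Hu' !normD NHD add0r -extend_coboundary !norm_extend.
rewrite norm_restrict Nu' restrictD -!norm_restrict Ey restrict_coboundary.
rewrite [coboundary (y + _)]coboundaryD [norm (_ y + _)]normD.
move: (norm u) (norm (coboundary w)) (extend _) => a b e.
by rewrite -!addrA cochain_addK cochain_addxx addr0.
Qed.

(** The Kuenneth formula for a product with a circle, with values in the
    reversal-invariant theory: the degree drops by one under [push] and is kept by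
    [restrict]. *)
Lemma betti_step n p k l : betti n p.+1 k -> betti n p.+2 l -> betti n.+1 p.+2 (k + l).
Proof.
case=> [phi [phiD phi0 phi_onto]] [psi [psiD psi0 psi_onto]].
exists (fun u => row_mx (phi (push u)) (psi (restrict u))); split=> [u v|u cu|t].
- by rewrite pushD restrictD phiD psiD add_row_mx.
- have phi0u := phi0 _ (cocycle_push cu); have psi0u := psi0 _ (cocycle_restrict cu).
  split=> [|eu].
    rewrite -row_mx0 => /eq_row_mx[/phi0u pu /psi0u ru].
    exact: trivial_of_fibre.
  by rewrite phi0u.2 ?psi0u.2 ?row_mx0 //; [apply: trivial_restrict | apply: trivial_push].
(* Both lifts have the prescribed image in one factor and zero in the other. *)
have [v cv phiv] := phi_onto (lsubmx t); have [w cw psiw] := psi_onto (rsubmx t).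
exists (cocycle_lift v + extend w).
  by apply: cocycleD; [apply: cocycle_lift_cocycle | apply: cocycle_extend].
rewrite pushD restrictD push_cocycle_lift restrict_cocycle_lift push_extend restrict_extend.
by rewrite addr0 add0r phiv psiw hsubmxK.
Qed.
End Homology.

(** * Betti numbers *)

(** A word over [0] and [1] is nondegenerate unless it is constantly [0]. *)
Lemma size_words1 n : size (words n 1) = (2 ^ n).-1.
Proof.
rewrite size_filter count_map.
rewrite (eq_count (a2 := predC1 [tuple of nseq n (@ord0 1)])); last first.
  move=> t /=; rewrite /onto /= andbT -[LHS]negbK; congr (~~ _).
  apply/idP/eqP => [tN1|->]; last by rewrite /= map_nseq mem_nseq andbF.
  apply: eq_from_tnth => i; rewrite [RHS](tnth_nth ord0) nth_nseq if_same.
  apply: val_inj; move: tN1; case: (tnth t i) (mem_tnth i t) => -[|[|//]] //= lt1 it.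
  by case/negP; apply/mapP; exists (Ordinal lt1).
have := cardC1 [tuple of nseq n (@ord0 1)].
by rewrite card_tuple card_ord cardE size_filter enumT.
Qed.

Lemma uniq_words n p : uniq (words n p).
Proof.
apply: filter_uniq; rewrite map_inj_uniq ?enum_uniq // => s t st.
by apply: val_inj; apply: inj_map st; apply: val_inj.
Qed.

Lemma sum_binomial n : \sum_(i < n.+1) 'C(n, i) = 2 ^ n.
Proof.
by rewrite -[2]/(1 + 1) expnDn; apply: eq_bigr => i _; rewrite !exp1n !muln1.
Qed.

Definition upper_binomial n p := \sum_(p <= j < n.+1) 'C(n, j).

Lemma upper_binomial1 n : upper_binomial n 1 = (2 ^ n).-1.
Proof. by rewrite -sum_binomial -(big_mkord xpredT) big_ltn // bin0. Qed.

(** Pascal's rule, summed: the same recurrence as in [betti_step]. *)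
Lemma upper_binomialS n p :
  upper_binomial n.+1 p.+1 = upper_binomial n p + upper_binomial n p.+1.
Proof.
rewrite /upper_binomial big_add1 /=.
under eq_bigr => j _ do rewrite binS addnC.
rewrite big_split /=; congr (_ + _); rewrite [RHS]big_add1 /=.
have [np|pn] := leqP p n; last by rewrite !big_geq // ltnW.
by rewrite big_nat_recr //= bin_small ?addn0.
Qed.

Lemma upper_binomial_xi n p : p <= n ->
  upper_binomial n p = \sum_(k < (n - p).+1) 'C(n, k).
Proof.
move=> pn; rewrite -(big_mkord xpredT (fun k => 'C(n, k))) -subSn //.
rewrite /upper_binomial -{1}(add0n p) big_addn big_nat_rev; apply: eq_big_nat => i ip.
by rewrite -[RHS]bin_sub; [congr 'C(_, _)|]; lia.
Qed.

Section Betti.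
Local Open Scope ring_scope.

Lemma betti1 n : betti n 1 (2 ^ n).-1.
Proof.
rewrite -size_words1 -(card_seq_sub (uniq_words n 1)).
exists (fun u => \row_(i < #|{: seq_sub (words n 1)}|) u (enum_val i)); split=> [u v|u _|t].
- by apply/rowP=> i; rewrite !mxE ffunE.
- split=> [u0|->]; last by apply/rowP=> i; rewrite !mxE ffunE.
  apply/ffunP=> w; rewrite ffunE; have /rowP/(_ (enum_rank w)) := u0.
  by rewrite !mxE enum_rankK.
exists [ffun w => t 0 (enum_rank w)]; last first.
  by apply/rowP=> i; rewrite mxE ffunE enum_valK.
by rewrite /is_cocycle norm_coboundary norm1 coboundary0.
Qed.

Lemma betti0 p : betti 0 p.+1 0.
Proof.
have C0 (u v : cochain 0 p.+1) : u = v.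
  by apply: cochainP => -[|//] _.
exists (fun=> 0); split=> [u v|u _|t].
- by rewrite addr0.
- split=> // _; case: p C0 u => [|p] C0 u; first exact: C0.
  by exists 0; rewrite coboundary0; congr norm; apply: C0.
by exists 0; [rewrite /is_cocycle coboundary0 norm0 | apply/rowP=> -[]].
Qed.

(** The recurrence starts from words of length [0], where there is no cochain,
    and from degree [1], where the space of all functions is its own cohomology. *)
Theorem betti_upper_binomial n p : betti n p.+1 (upper_binomial n p.+1).
Proof.
elim: n p => [|n IHn] [|p].
- by rewrite upper_binomial1; apply: betti1.
- by rewrite /upper_binomial big_geq //; apply: betti0.
- by rewrite upper_binomial1; apply: betti1.
by rewrite upper_binomialS; apply: betti_step.
Qed.
End Betti.

(** * Words and labels *)

(** The list of blocks ends with block [0], hence this correspondence between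
    positions in the list and block numbers. *)
Definition slot p k := if k == p then 0 else k.+1.

Lemma nth_rot (T : Type) (x : T) r s k : r <= size s -> k < size s ->
  nth x (rot r s) k = nth x s (if k + r < size s then k + r else k + r - size s).
Proof.
move=> rs ks; rewrite nth_cat size_drop nth_drop ltn_subRL addnC.
case: ifP => // ksr; rewrite nth_take; last by lia.
by congr nth; lia.
Qed.

Lemma nth_map0 (f : nat -> nat) w k : f 0 = 0 -> nth 0 (map f w) k = f (nth 0 w k).
Proof.
move=> f0; have [kw|wk] := ltnP k (size w); first exact: nth_map.
by rewrite !nth_default ?size_map.
Qed.

Lemma nth_bounded p w k : bounded p w -> nth 0 w k <= p.
Proof.
move=> wp; have [kw|wk] := ltnP k (size w); last by rewrite nth_default.
by apply: (allP wp); rewrite mem_nth.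
Qed.

Lemma onto_le_size n p w : word_shape n p w -> onto p w -> p <= n.
Proof.
case/andP=> /eqP wn _ /allP wo; rewrite -wn -(size_iota 1 p).
by apply: uniq_leq_size (iota_uniq 1 p) _ => x /wo.
Qed.

Section Labels.
Variable n : nat.
Implicit Types (w v : seq nat) (s t : label n) (i : 'I_n.+1).

(** The largest element has no letter in a word of length [n]; the default value
    [0] of [nth] puts it into block [0]. *)
Definition block w y : {set 'I_n.+1} := [set i : 'I_n.+1 | nth 0 w i == y].

Definition blocks p w : seq {set 'I_n.+1} := mkseq (fun k => block w (slot p k)) p.+1.

Definition label_of p w : label n := insub_bseq n.+1 (blocks p w).

Lemma val_label_of p w : p <= n -> label_of p w = blocks p w :> seq _.
Proof. by move=> pn; rewrite /label_of val_insubd size_mkseq ltnS pn. Qed.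

Lemma nth_blocks p w k : k <= p -> nth set0 (blocks p w) k = block w (slot p k).
Proof. by move=> kp; rewrite nth_mkseq. Qed.

Lemma word_shape_nth_max p w : word_shape n p w -> nth 0 w (@ord_max n) = 0.
Proof. by case/andP=> /eqP wn _; rewrite nth_default // wn. Qed.

Lemma block_neq0 p w y : word_shape n p w -> onto p w -> y <= p -> block w y != set0.
Proof.
move=> wp /allP wo yp; have wn : size w = n by case/andP: wp => /eqP.
case: y yp => [|y] yp; apply/set0Pn.
  by exists ord_max; rewrite inE (word_shape_nth_max wp).
have /(nthP 0)[i iw iE] : y.+1 \in w by apply: wo; rewrite mem_iota; lia.
have i_n : i < n.+1 by rewrite -wn ltnW.
by exists (Ordinal i_n); rewrite inE iE.
Qed.

Lemma label_of_cyclic p w : word_shape n p w -> onto p w -> cyclic_partition (label_of p w).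
Proof.
move=> wp wo; have pn := onto_le_size wp wo; have wb := andP wp.
rewrite /cyclic_partition /ordered_partition val_label_of //; apply/andP; split.
  apply/and3P; split.
  - apply/mapP=> -[k]; rewrite mem_iota => kp /esym/eqP; apply/negP.
    by apply: block_neq0 wp wo _; rewrite /slot; case: eqP; lia.
  - rewrite pairwise_map; apply: (@sub_in_pairwise _ (fun k => k < p.+1) (fun j k =>
      j != k)).
    + move=> j k; rewrite !unfold_in => jp kp jk.
      apply/pred0P => i; rewrite /= !inE; apply/negP=> /andP[/eqP-> /eqP].
      by rewrite /slot; do 2!case: eqP; lia.
    + by apply/allP=> k; rewrite mem_iota.
    by rewrite -uniq_pairwise iota_uniq.
  apply/eqP/setP=> i; rewrite inE bigcup_seq; apply/bigcupP.
  have := nth_bounded i wb.2; set x := nth 0 w i => xp.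
  exists (block w x); last by rewrite inE.
  apply/mapP; exists (if x == 0 then p else x.-1).
    by rewrite mem_iota; case: eqP; lia.
  by rewrite /slot; case: (eqVneq x 0) => [->|x0]; rewrite ?eqxx // ifF ?prednK ?lt0n //;
    lia.
rewrite -nth_last size_mkseq nth_blocks // /slot eqxx inE.
by rewrite (word_shape_nth_max wp).
Qed.

Lemma label_of_reversal p w : word_shape n p w -> onto p w ->
  reversal (label_of p w) = label_of p (map (flip p) w).
Proof.
move=> wp wo; have pn := onto_le_size wp wo; have wb := andP wp.
apply: val_inj; rewrite /= !val_label_of //; apply: (@eq_from_nth _ set0).
  by rewrite size_rot size_rev !size_mkseq.
move=> k; rewrite size_rot size_rev size_mkseq => kp.
rewrite nth_rot ?size_rev ?size_mkseq // nth_rev size_mkseq; last by case: ifP; lia.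
rewrite !nth_blocks //; last by case: ifP; lia.
apply/setP=> i; rewrite !inE nth_map0 //; have := nth_bounded i wb.2.
rewrite /slot; set b1 := (k + 1 < p.+1); case: (boolP b1) => kp1 xp.
  by apply/eqP/eqP; arith.
by apply/eqP/eqP; arith.
Qed.

Lemma blocks_inj p w v : word_shape n p w -> word_shape n p v -> blocks p w =
  blocks p v -> w = v.
Proof.
move=> wp vp wv; have [/eqP wn wb] := andP wp; have [/eqP vn _] := andP vp.
apply: (@eq_from_nth _ 0) => [|k]; rewrite wn // => kn.
have := nth_bounded k wb; set x := nth 0 w k => xp.
have := congr1 (fun l : seq _ => nth set0 l (if x == 0 then p else x.-1)) wv.
rewrite !nth_blocks; try by case: eqP; lia.
have -> : slot p (if x == 0 then p else x.-1) = x.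
  by rewrite /slot; case: (eqVneq x 0) => [->|x0]; rewrite ?eqxx // ifF ?prednK ?lt0n //;
    lia.
by move/setP/(_ (Ordinal (ltnW kn : k < n.+1))); rewrite !inE /= eqxx => /esym/eqP.
Qed.

Lemma label_of_inj p q w v : word_shape n p w -> onto p w -> word_shape n q v -> onto q v ->
  label_of p w = label_of q v -> p = q /\ w = v.
Proof.
move=> wp wo vq vo /(congr1 val); rewrite /= !val_label_of ?(onto_le_size wp wo)
  ?(onto_le_size vq vo) //.
move=> wv; have pq : p = q by have := congr1 size wv; rewrite !size_mkseq => -[].
by split=> //; move: vq vo wv; rewrite -pq => vp _; apply: blocks_inj.
Qed.

(** The letter at [i] is the number of the block of [i], found by search. *)
Lemma label_ofP s p : cyclic_partition s -> size s = p.+1 ->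
  exists2 w, word_shape n p w && onto p w & label_of p w = s.
Proof.
case/andP=> /and3P[s0 sdis /eqP scov] smax sp.
have pn : p <= n by have := size_bseq s; rewrite sp.
pose f (i : 'I_n.+1) := find (fun A : {set 'I_n.+1} => i \in A) s.
have fs i : f i < p.+1.
  rewrite -sp -has_find; have : i \in \bigcup_(A <- s) A by rewrite scov inE.
  by rewrite bigcup_seq => /bigcupP[A As iA]; apply/hasP; exists A.
have fP i k : k <= p -> (i \in nth set0 s k) = (f i == k).
  move=> kp; have iF : i \in nth set0 s (f i).
    by apply: (@nth_find _ set0 (fun A : {set 'I_n.+1} => i \in A)); rewrite has_find sp;
      apply: fs.
  apply/idP/eqP => [ik|<- //].
  have := pairwiseP set0 sdis; rewrite /sorted.
  move=> dis; have [fk|kf|//] := ltngtP (f i) k.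
    have := dis (f i) k; rewrite !inE sp => /(_ (fs i) kp fk)/pred0P/(_ i).
    by rewrite /= iF ik.
  have := dis k (f i); rewrite !inE sp => /(_ kp (fs i) kf)/pred0P/(_ i).
  by rewrite /= iF ik.
have fmax : f ord_max = p.
  by apply/eqP; rewrite -fP // -[p]/(p.+1.-1) -sp nth_last.
pose w := mkseq (fun k => slot p (f (inord k))) n.
have wE i : nth 0 w i = slot p (f i).
  have [i_n|ni] := ltnP i n; first by rewrite nth_mkseq // inord_val.
  have -> : i = ord_max by apply: val_inj; apply/eqP; rewrite /= eqn_leq ni -ltnS ltn_ord.
  by rewrite nth_default ?size_mkseq // fmax /slot eqxx.
have wp : word_shape n p w.
  rewrite /word_shape size_mkseq eqxx; apply/allP=> _ /mapP[k _ ->]; rewrite /slot.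
  by have := fs (inord k); case: eqP; lia.
have wblocks : blocks p w = s.
  apply: (@eq_from_nth _ set0); rewrite size_mkseq ?sp // => k kp.
  rewrite nth_blocks //; apply/setP=> i; rewrite inE wE fP // /slot.
  by have := fs i; arith.
exists w; last by apply: val_inj; rewrite /= val_label_of.
rewrite wp; apply/allP=> y; rewrite mem_iota => yp.
have : nth set0 s y.-1 \in (s : seq _) by rewrite mem_nth // sp; lia.
rewrite /= -wblocks; case: (set_0Vmem (nth set0 (blocks p w) y.-1)) => [->|[i]].
  by rewrite wblocks (negPf s0).
rewrite nth_blocks; last by lia.
rewrite inE => /eqP iE _; have <- : nth 0 w i = y by rewrite iE /slot; case: eqP; lia.
apply: mem_nth; rewrite ltnNge; apply/negP=> wi; move: iE.
by rewrite nth_default // /slot; case: eqP; lia.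
Qed.
End Labels.

(** * Refinements by one block *)

Section Fuse.
Variable T : finType.
Implicit Types (S : seq {set T}) (l : seq nat).

(** A refinement by one block cuts the finer list into singleton runs and one
    run of length two. *)
Definition fuse i S : seq {set T} :=
  take i S ++ (nth set0 S i :|: nth set0 S i.+1) :: drop i.+2 S.

Definition pair_shape i k : seq nat := nseq i 1 ++ 2 :: nseq k 1.

Lemma size_fuse i S : i.+1 < size S -> size (fuse i S) = (size S).-1.
Proof. by move=> iS; rewrite size_cat /= size_drop size_take; case: ifP; lia. Qed.

Lemma nth_fuse i S k : i.+1 < size S -> nth set0 (fuse i S) k =
  if k < i then nth set0 S k else if k == i then nth set0 S i :|: nth set0 S i.+1
  else nth set0 S k.+1.
Proof.
move=> iS; rewrite nth_cat size_takel; last by lia.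
case: ltngtP => [ki|ik|->]; first by rewrite nth_take.
  have -> : k - i = (k - i.+1).+1 by lia.
  by rewrite /= nth_drop; congr nth; lia.
by rewrite subnn.
Qed.

Lemma unions_singletons S k : size S = k ->
  [seq \bigcup_(A <- run) A | run <- reshape (nseq k 1) S] = S.
Proof.
by elim: S k => [|A S IHS] [|k] //= [/IHS]; rewrite take0 drop0 big_seq1 => ->.
Qed.

Lemma unions_pair_shape i k S : size S = i + k + 2 ->
  [seq \bigcup_(A <- run) A | run <- reshape (pair_shape i k) S] = fuse i S.
Proof.
elim: i S => [|i IHi] [|A S] Sk; first by rewrite addn2 in Sk.
- case: S Sk => [|B S] Sk; first by rewrite addn2 in Sk.
  rewrite /fuse /= take0 !drop0 big_cons big_seq1 unions_singletons //.
  by move: Sk => /=; lia.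
- by rewrite addn2 in Sk.
by rewrite /= take0 drop0 big_seq1 IHi //; move: Sk => /=; lia.
Qed.

Lemma shape_all1 l : 0 \notin l -> sumn l <= size l -> l = nseq (size l) 1.
Proof.
elim: l => //= x l IHl; rewrite inE negb_or => /andP[x0 l0] xl.
have ll : size l <= sumn l.
  elim: l l0 {IHl xl} => //= y l IHl; rewrite inE negb_or => /andP[y0 /IHl]; lia.
by rewrite -IHl //; [congr (_ :: _)|]; lia.
Qed.

Lemma shape_pair l : 0 \notin l -> sumn l = (size l).+1 ->
  exists2 i, i < size l & l = pair_shape i (size l - i.+1).
Proof.
elim: l => //= x l IHl; rewrite inE negb_or => /andP[x0 l0] xl.
have ll : size l <= sumn l.
  elim: l l0 {IHl xl} => //= y l IHl; rewrite inE negb_or => /andP[y0 /IHl]; lia.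
have [x1|x1] := eqVneq x 1.
  have [|i il lE] := IHl l0; first by lia.
  by exists i.+1 => //; rewrite x1 {1}lE.
exists 0 => //; rewrite subSS subn0 /pair_shape /= -shape_all1 //; last by lia.
by congr (_ :: _); lia.
Qed.
End Fuse.

Section Faces.
Variable n : nat.
Implicit Types (w v : seq nat) (s t : label n).

Lemma refines_fuse s t : size s = (size t).+1 ->
  refines s t <-> exists k i, [/\ k < size s, i.+1 < size s & val t = fuse i (rot k s)].
Proof.
move=> st; split=> [/existsP[k /existsP[sh /and3P[sh0 /eqP shs /eqP tE]]]|].
  have [|i] := shape_pair sh0; first by rewrite size_map size_tuple shs -st.
  rewrite size_map size_tuple => it shE.
  exists k, i; split=> //; first by rewrite st.
  rewrite -(unions_pair_shape (k := size t - i.+1)) -?shE ?tE // size_rot st; lia.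
case=> k [i [ks is_ tE]]; apply/existsP; exists (Ordinal ks).
pose l := pair_shape i (size t - i.+1).
have lt : size (map (@inord (size s)) l) == size t.
  by rewrite size_map size_cat /= !size_nseq; lia.
have lE : [seq val j | j <- map (@inord (size s)) l] = l.
  rewrite -map_comp -[RHS]map_id; apply/eq_in_map=> x /=.
  rewrite mem_cat inE !mem_nseq => xl; rewrite inordK //; lia.
apply/existsP; exists (Tuple lt); rewrite lE; apply/and3P; split.
- by rewrite mem_cat inE !mem_nseq; lia.
- by rewrite sumn_cat /= !sumn_nseq; lia.
rewrite unions_pair_shape; first by apply/eqP.
by rewrite size_rot; lia.
Qed.

Lemma fuse_blocks p w j : bounded p.+1 w -> j <= p ->
  fuse j (blocks n p.+1 w) = blocks n p (map (merge_blocks p.+1 j.+1) w).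
Proof.
move=> wp jp; apply: (@eq_from_nth _ set0).
  by rewrite size_fuse !size_mkseq.
rewrite size_fuse size_mkseq // => k kp; rewrite nth_fuse ?size_mkseq //.
apply/setP=> i; have xp := nth_bounded i wp.
have kp' : k <= p by [].
rewrite [in RHS]nth_blocks // [RHS]inE nth_map0; last by arith.
by case: ltngtP => [kj|jk|->]; rewrite !nth_blocks ?inE /slot; try lia;
  move: (nth 0 w i) xp => x xp; apply/idP/idP; arith.
Qed.

Lemma fuse_rot_blocks p w : bounded p.+1 w ->
  fuse p (rot 1 (blocks n p.+1 w)) = blocks n p (map (merge_blocks p.+1 0) w).
Proof.
move=> wp; apply: (@eq_from_nth _ set0).
  by rewrite size_fuse size_rot !size_mkseq.
rewrite size_fuse size_rot size_mkseq // => k kp; rewrite nth_fuse ?size_rot ?size_mkseq //.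
apply/setP=> i; have xp := nth_bounded i wp.
have kp' : k <= p by [].
rewrite [in RHS]nth_blocks // [RHS]inE nth_map0; last by arith.
case: ltngtP => [kj|jk|kE]; first 1 last; first by lia.
  rewrite 2?nth_rot ?size_mkseq //; try lia.
  rewrite ifT ?ifF; try lia.
  rewrite !nth_blocks ?inE /slot; try lia.
  by move: (nth 0 w i) xp => x xp; apply/idP/idP; arith.
rewrite nth_rot ?size_mkseq //; try lia.
rewrite ifT; try lia.
rewrite nth_blocks ?inE /slot; try lia.
by move: (nth 0 w i) xp => x xp; apply/idP/idP; arith.
Qed.

(** In a rotated label the largest element must again lie in the last fused
    block. This leaves the rotation by [0], and the rotation by [1] if the fused pair
    is the last one; the latter is the face [j = 0]. *)
Lemma refines_label_of p w s : word_shape n p.+1 w -> onto p.+1 w ->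
    size s = p.+1 -> ord_max \in last set0 s ->
  refines (label_of n p.+1 w) s <->
  exists2 j, j <= p.+1 & s = label_of n p (map (merge_blocks p.+1 j) w).
Proof.
move=> wp wo sp smax; have pn := onto_le_size wp wo; have wb := (andP wp).2.
have Sw : size (label_of n p.+1 w) = p.+2 by rewrite val_label_of // size_mkseq.
rewrite refines_fuse ?Sw ?sp // val_label_of //; split=> [[k [i [kp ip sE]]]|[j jp ->]];
  last first.
  rewrite /= val_label_of ?(ltnW pn) //; case: j jp => [|j] jp.
    by exists 1, p; rewrite fuse_rot_blocks.
  by exists 0, j; rewrite rot0 fuse_blocks.
pose S := blocks n p.+1 w; have sizeS : size S = p.+2 by rewrite size_mkseq.
have maxS l : l <= p.+1 -> ord_max \in nth set0 S l -> l = p.+1.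
  by move=> lp; rewrite nth_blocks // inE (word_shape_nth_max wp) /slot; case: (l =P p.+1).
have : ord_max \in last set0 (fuse i (rot k S)) by rewrite -sE.
rewrite -nth_last size_fuse ?size_rot ?sizeS // nth_fuse ?size_rot ?sizeS //= ltnNge.
have -> : i <= p by []. rewrite /=.
have k01 : k = 0 -> exists2 j, j <= p.+1 & s = label_of n p (map (merge_blocks p.+1 j) w).
  move=> k0; exists i.+1 => //; apply: val_inj.
  by rewrite /= val_label_of ?(ltnW pn) // -fuse_blocks // sE k0 rot0.
case: eqP => [pi|pi]; last first.
  rewrite nth_rot ?sizeS //; last by rewrite ltnW.
  by case: ifP => kp1 /maxS lE; apply: k01; lia.
rewrite inE => /orP[]; rewrite nth_rot ?sizeS //; try lia; last first.
  by case: ifP => kp1 /maxS lE; apply: k01; lia.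
case: ifP => kp1 /maxS lE; last by lia.
have k1 : k = 1 by lia.
exists 0 => //; apply: val_inj.
by rewrite /= val_label_of ?(ltnW pn) // -fuse_rot_blocks // sE k1 pi.
Qed.
End Faces.

(** * Cells and the cellular boundary *)

Section Cells.
Variable n : nat.
Implicit Types (w v : seq nat) (s t : label n) (F : qp_cell n) (c : chain n).

Definition cell_word p w : bool := word_shape n p w && onto p w.

Definition label_orbit p w : {set label n} := [set label_of n p w;
  label_of n p (map (flip p) w)].

Lemma flip_flip p x : x <= p -> flip p (flip p x) = x.
Proof. arith. Qed.

Lemma flip_le p x : x <= p -> flip p x <= p.
Proof. arith. Qed.

Lemma flipK p w : bounded p w -> map (flip p) (map (flip p) w) = w.
Proof.
by move=> wp; rewrite -map_comp -[RHS]map_id; apply: eq_map_bounded wp => x /=; arith.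
Qed.

Lemma cell_word_flip p w : cell_word p w -> cell_word p (map (flip p) w).
Proof.
case/andP=> wp /allP wo; apply/andP; split.
  by apply: word_shape_map wp => x xp; arith.
apply/allP=> y; rewrite mem_iota => yp; apply/mapP; exists (flip p y); last by arith.
by apply: wo; rewrite mem_iota; arith.
Qed.

Lemma cell_word_merge p w j : j <= p.+1 -> cell_word p.+1 w ->
  cell_word p (map (merge_blocks p.+1 j) w).
Proof.
move=> jp /andP[wp /allP wo]; apply/andP; split.
  by apply: word_shape_map wp => x xp; arith.
apply/allP=> y; rewrite mem_iota => yp; apply/mapP.
(* A section of the face map. *)
exists (if y <= j then y else y.+1); last by arith.
by apply: wo; rewrite mem_iota; case: ifP; lia.
Qed.

Lemma orbit_flip p w : cell_word p w -> label_orbit p (map (flip p) w) = label_orbit p w.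
Proof.
by case/andP=> /andP[_ wp] _; rewrite /label_orbit flipK // setUC.
Qed.

Lemma orbit_inj p q w v : cell_word p w -> cell_word q v -> label_orbit p w =
  label_orbit q v ->
  p = q /\ (w = v \/ w = map (flip q) v).
Proof.
move=> /andP[wp wo] qv wv; have /andP[vq vo] := qv; have /andP[fq fo] := cell_word_flip qv.
have : label_of n p w \in label_orbit q v by rewrite -wv !inE eqxx.
rewrite !inE => /orP[] /eqP /label_of_inj[] // pq ->; split=> //; first by left.
by right.
Qed.

Lemma cell_orbit F : exists p w, cell_word p.+2 w /\ val F = label_orbit p.+2 w.
Proof.
have /existsP[s /andP[/andP[sc s3] /eqP->]] := valP F.
have ss : size s = ((size s - 3)).+3 by rewrite -addn3 subnK.
have [w wv <-] := label_ofP sc ss; exists (size s - 3), w; split=> //.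
by case/andP: wv => wp wo; rewrite label_of_reversal.
Qed.

Lemma orbit_cell p w : cell_word p.+2 w -> exists F, val F = label_orbit p.+2 w.
Proof.
case/andP=> wp wo.
suff oP : [exists s : label n, cp_label s && (label_orbit p.+2 w == [set s; reversal s])].
  by exists (exist (fun C : {set label n} => [exists s : label n, cp_label s && (C ==
    [set s; reversal s])]) _ oP).
apply/existsP; exists (label_of n p.+2 w); rewrite /cp_label label_of_cyclic //
  label_of_reversal //.
by rewrite val_label_of ?(onto_le_size wp wo) // size_mkseq eqxx.
Qed.

Lemma size_orbit p w s : cell_word p w -> s \in label_orbit p w -> size s = p.+1.
Proof.
move=> wv; have /andP[wp wo] := wv; have pn := onto_le_size wp wo.
by rewrite !inE => /orP[] /eqP->; rewrite val_label_of // size_mkseq.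
Qed.

Lemma nblocks_orbit p w F : cell_word p w -> val F = label_orbit p w -> nblocks F = p.+1.
Proof.
move=> wv FE; apply/eqP; rewrite eqn_leq; apply/andP; split.
  by apply/bigmax_leqP => s; rewrite FE => /(size_orbit wv) ->.
have wF : label_of n p w \in val F by rewrite FE !inE eqxx.
rewrite -(size_orbit (s := label_of n p w) wv) -?FE //.
exact: (leq_bigmax_cond (F := fun s : label n => size s)).
Qed.

Lemma dim_orbit p w F : cell_word p w -> val F = label_orbit p w ->
  Defs.dim F = (n%:Z - p%:Z)%R.
Proof. by move=> wv /(nblocks_orbit wv); rewrite /Defs.dim => ->; lia. Qed.

(** The pair of letters that a face identifies determines the face. *)
Lemma merge_inj p i j : i <= p.+3 -> j <= p.+3 ->
  (forall y, 0 < y <= p.+3 -> merge_blocks p.+3 i y = merge_blocks p.+3 j y) -> i = j.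
Proof.
move=> ip jp ij; have [lij|lji|//] := ltngtP i j.
  by have := ij i.+1 (leq_trans lij jp); arith.
by have := ij j.+1 (leq_trans lji ip); arith.
Qed.

(** A face preserves the cyclic order of the blocks and [flip] reverses it; with
    at least three blocks left, the two orders differ. *)
Lemma merge_flip_neq p i j :
  ~ (forall y, 0 < y <= p.+3 -> merge_blocks p.+3 i y = flip p.+2 (merge_blocks p.+3 j y)).
Proof.
move=> ij; have j0 : j = 0 by have := ij 1 isT; arith.
have i0 : i = 0 by have := ij 1 isT; rewrite j0; arith.
by have := ij 2 isT; rewrite i0 j0; arith.
Qed.

Lemma orbit_merge_inj p w i j : cell_word p.+3 w -> i <= p.+3 -> j <= p.+3 ->
  label_orbit p.+2 (map (merge_blocks p.+3 i) w) =
    label_orbit p.+2 (map (merge_blocks p.+3 j) w) -> i = j.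
Proof.
move=> wv ip jp; have /andP[_ /allP wo] := wv.
have inw y : 0 < y <= p.+3 -> y \in w by move=> yp; apply: wo; rewrite mem_iota; lia.
case/orbit_inj; try exact: cell_word_merge.
move=> _ [|]; rewrite -?map_comp => /eq_in_map ij.
  by apply: (merge_inj ip jp) => y /inw /ij.
by case: (@merge_flip_neq p i j) => y /inw /ij.
Qed.

Lemma dim_next (m p q : nat) : (m%:Z - q.+2%:Z = m%:Z - p.+3%:Z + 1)%R -> q = p.
Proof. lia. Qed.

(** The cells that [F'] refines by one block are its faces as a simplex: both
    representatives of the orbit lead to the same cells, since reversal permutes the
    face maps. *)
Lemma covers_orbit p w F F' : cell_word p.+3 w -> val F' = label_orbit p.+3 w ->
  (Defs.dim F == Defs.dim F' + 1)%R && face F' F =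
  [exists j : 'I_p.+4, val F == label_orbit p.+2 (map (merge_blocks p.+3 j) w)].
Proof.
move=> wv F'E; have /andP[wp wo] := wv; have wb := (andP wp).2.
apply/andP/existsP => [[/eqP dimF /existsP[s' /andP[s'F /existsP[s /andP[sF ss]]]]]|[j
  /eqP FE]].
  have [q [v0 [vv FE0]]] := cell_orbit F.
  have qp : q = p by move: dimF; rewrite (dim_orbit vv FE0) (dim_orbit wv F'E) => /dim_next.
  rewrite {}qp in vv FE0.
  have [v [{}vv FE sE]] : exists v, [/\ cell_word p.+2 v, val F =
    label_orbit p.+2 v & s = label_of n p.+2 v].
    move: sF; rewrite FE0 !inE => /orP[] /eqP->; first by exists v0.
    exists (map (flip p.+2) v0); split=> //; first exact: cell_word_flip.
    by rewrite orbit_flip.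
  have /andP[vp vo] := vv.
  have smax : ord_max \in last set0 s by rewrite sE; case/andP: (label_of_cyclic vp vo).
  have ssize : size s = p.+3 by apply: (size_orbit vv); rewrite -FE.
  have mergeE w' : cell_word p.+3 w' -> refines (label_of n p.+3 w') s ->
      exists2 j, j <= p.+3 & v = map (merge_blocks p.+3 j) w'.
    move=> w'v; have /andP[w'p w'o] := w'v.
    case/(refines_label_of w'p w'o ssize smax) => j jp; rewrite sE.
    have /andP[mp mo] := cell_word_merge jp w'v.
    by case/label_of_inj => // _ ->; exists j.
  move: s'F; rewrite F'E !inE => /orP[] /eqP s'E; rewrite s'E in ss.
    have [j jp vE] := mergeE _ wv ss.
    by exists (Ordinal (jp : j < p.+4)); rewrite FE vE.
  have [j jp vE] := mergeE _ (cell_word_flip wv) ss.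
  have jp' : p.+3 - j < p.+4 by rewrite ltnS leq_subr.
  exists (Ordinal jp'); rewrite FE -orbit_flip //; apply/eqP; congr label_orbit.
  rewrite vE -!map_comp; apply: eq_map_bounded wb => x xp /=.
  by rewrite flip_merge ?flip_flip ?flip_le.
have mv : cell_word p.+2 (map (merge_blocks p.+3 j) w) by apply: cell_word_merge wv;
  rewrite -ltnS.
split; first by rewrite (dim_orbit mv FE) (dim_orbit wv F'E); lia.
apply/existsP; exists (label_of n p.+3 w); rewrite F'E !inE eqxx /=.
have /andP[mp mo] := mv.
apply/existsP; exists (label_of n p.+2 (map (merge_blocks p.+3 j) w));
  rewrite FE !inE eqxx /=.
apply/(refines_label_of wp wo).
- by rewrite (size_orbit mv) // !inE eqxx.
- by case/andP: (label_of_cyclic mp mo).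
by exists j => //; rewrite -ltnS.
Qed.

Section Chains.
Local Open Scope ring_scope.

Definition chain_at c (C : {set label n}) : 'Z_2 := oapp c 0 (insub C).

Lemma chain_atE c C F : val F = C -> chain_at c C = c F.
Proof. by move=> <-; rewrite /chain_at valK. Qed.

Lemma sum_chain_at c C : \sum_F (if val F == C then c F else 0) = chain_at c C.
Proof.
rewrite /chain_at; case: insubP => [F _ <-|CN] /=.
  rewrite (bigD1 F) //= eqxx big1 ?addr0 // => G GF.
  by rewrite ifF //; apply/negP => /eqP/val_inj GE; rewrite GE eqxx in GF.
rewrite big1 // => F _; rewrite ifF //; apply/negP => /eqP FC.
by case/negP: CN; rewrite -FC; exact: (valP F).
Qed.

(** Distinct face maps give distinct cells, so each nonzero incidence number is
    counted once, and the cellular boundary becomes the simplicial coboundary. *)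
Lemma boundary_orbit p w c F : cell_word p.+3 w -> val F = label_orbit p.+3 w ->
  boundary c F =
  \sum_(0 <= j < p.+4) chain_at c (label_orbit p.+2 (map (merge_blocks p.+3 j) w)).
Proof.
move=> wv FE; rewrite ffunE big_mkord.
under [RHS]eq_bigr => j _ do rewrite -sum_chain_at.
rewrite exchange_big; apply: eq_bigr => G _.
rewrite /incidence (covers_orbit _ wv FE).
case: existsP => [[j /eqP GE]|GN]; last first.
  rewrite mul0r big1 // => j _; case: eqP => // GE; case: GN; exists j; exact/eqP.
rewrite mul1r (bigD1 j) //= GE eqxx big1 ?addr0 // => i ij.
case: eqP => // /(orbit_merge_inj wv) eij; case/eqP: ij; apply: val_inj.
by rewrite /= eij // -ltnS.
Qed.
End Chains.
End Cells.

(** * From cochains to the homology of the cell complex *)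

Section Transfer.
Variable n : nat.
Local Open Scope ring_scope.
Implicit Types (c d : chain n) (F : qp_cell n).

Definition degree p : int := n%:Z - p.+2%:Z.

(** A chain read as a reversal-invariant cochain. *)
Definition lift_chain p c : cochain n p.+2 :=
  [ffun x => chain_at c (label_orbit n p.+2 (val x))].

Definition descend p (u : cochain n p.+2) : chain n :=
  finfun (fun F : qp_cell n =>
    (if [pick x : seq_sub (words n p.+2) | val F == label_orbit n p.+2 (val x)] is Some x
     then u x else 0) : 'Z_2).

Lemma cell_word_val p (x : seq_sub (words n p)) : cell_word n p (val x).
Proof. by have := valP x; rewrite mem_words. Qed.

Lemma ev_lift_chain p c w : cell_word n p.+2 w -> ev (lift_chain p c) w =
  chain_at c (label_orbit n p.+2 w).
Proof.
move=> wv; have ww : w \in words n p.+2 by rewrite mem_words.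
by rewrite /ev insubT /= ffunE.
Qed.

Lemma chain_atD c d C : chain_at (c + d) C = chain_at c C + chain_at d C.
Proof. by rewrite /chain_at; case: insub => [F|] /=; rewrite ?ffunE ?addr0. Qed.

Lemma ev_lift_cell p c w F : cell_word n p.+2 w -> val F = label_orbit n p.+2 w ->
  ev (lift_chain p c) w = c F.
Proof. by move=> wv FE; rewrite ev_lift_chain // (chain_atE _ FE). Qed.

Lemma norm_lift_chain p c : norm (lift_chain p c) = 0.
Proof.
apply: cochainP => w wp wo; have wv : cell_word n p.+2 w by rewrite /cell_word wp.
rewrite ev0 /norm evD (ev_pull _ (@natural_mirror _ _)) // sum_mirror.
by rewrite !ev_lift_chain ?cell_word_flip // orbit_flip // Z2_addxx.
Qed.

Lemma coboundary_lift_chain p c : coboundary (lift_chain p c) =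
  lift_chain p.+1 (boundary c).
Proof.
apply: cochainP => w wp wo; have wv : cell_word n p.+3 w by rewrite /cell_word wp.
have [F FE] := orbit_cell wv.
rewrite (ev_pull _ (@natural_faces _ _)) // sum_faces (ev_lift_cell _ wv FE).
rewrite (boundary_orbit _ wv FE); apply: eq_big_nat => j /andP[_ jp].
by rewrite ev_lift_chain // cell_word_merge.
Qed.

Lemma norm_eq0 p (u : cochain n p) w : word_shape n p w -> norm u = 0 ->
  ev u (map (flip p) w) = ev u w.
Proof.
move=> wp /(congr1 (fun v => ev v w)); rewrite /norm evD ev0.
by rewrite (ev_pull _ (@natural_mirror _ _)) // sum_mirror => /Z2_eq.
Qed.

Lemma lift_chainK p (u : cochain n p.+2) : norm u = 0 -> lift_chain p (descend u) = u.
Proof.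
move=> Nu; apply: cochainP => w wp wo; have wv : cell_word n p.+2 w by rewrite /cell_word
  wp.
have [F FE] := orbit_cell wv.
rewrite (ev_lift_cell _ wv FE) ffunE; case: pickP => [x /eqP Fx|noF].
  rewrite -ev_val; have xv := cell_word_val x.
  (* The word picked for the cell is [w] or its mirror image. *)
  have [|_ [->|->] //] := orbit_inj wv xv; first by rewrite -FE.
  by rewrite norm_eq0 //; case/andP: xv.
have ww : w \in words n p.+2 by rewrite mem_words.
by have /eqP[] := noF (SeqSub ww).
Qed.

Lemma mem_chains c i : reflect (forall F, Defs.dim F != i -> c F = 0) (c \in chains n i).
Proof. by rewrite inE; apply: (iffP forall_inP) => cP F /cP /eqP. Qed.

Lemma descend_chains p (u : cochain n p.+2) : descend u \in chains n (degree p).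
Proof.
apply/mem_chains => F dimF; rewrite ffunE; case: pickP => // x /eqP FE.
by rewrite (dim_orbit (cell_word_val x) FE) eqxx in dimF.
Qed.

Lemma degree_inj p q : degree p = degree q -> p = q.
Proof. rewrite /degree; lia. Qed.

Lemma degree_next p : degree p = degree p.+1 + 1.
Proof. rewrite /degree; lia. Qed.

Lemma lift_chain_inj p c d : c \in chains n (degree p) -> d \in chains n (degree p) ->
  lift_chain p c = lift_chain p d -> c = d.
Proof.
move=> /mem_chains cp /mem_chains dp cd; apply/ffunP=> F.
have [q [w [wv FE]]] := cell_orbit F.
have [/degree_inj qp|qp] := eqVneq (degree q) (degree p).
  by rewrite qp in wv FE; rewrite -!(ev_lift_cell _ wv FE) cd.
by rewrite cp ?dp // (dim_orbit wv FE).
Qed.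

Lemma lift_chain0 p : lift_chain p 0 = 0.
Proof.
apply/ffunP=> x; rewrite !ffunE /chain_at.
by case: insub => [F|] //=; rewrite ffunE.
Qed.

Lemma boundary0 : boundary (0 : chain n) = 0.
Proof. by apply/ffunP=> F; rewrite !ffunE big1 // => G _; rewrite ffunE mulr0. Qed.

Lemma chains0 i : (0 : chain n) \in chains n i.
Proof. by apply/mem_chains => F _; rewrite ffunE. Qed.

Lemma boundary_chains c i : c \in chains n (i + 1) -> boundary c \in chains n i.
Proof.
move=> /mem_chains ci; apply/mem_chains => F Fi; rewrite ffunE big1 // => G _.
rewrite /incidence; case: eqP => [GF|_] /=; last by rewrite mul0r.
by rewrite ci ?mulr0 // GF; apply: contra Fi => /eqP/addIr->.
Qed.

Lemma mem_cycles c i : (c \in cycles n i) = (c \in chains n i) && (boundary c == 0).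
Proof. by rewrite in_setI; congr andb; rewrite in_setI inE /= in_set inE. Qed.

Lemma mem_boundaries c i :
  (c \in boundaries n i) <-> exists2 b, b \in chains n (i + 1) & c = boundary b.
Proof.
split=> [/morphimP[b _ bi ->]|[b bi ->]]; first by exists b.
exact: (mem_morphim (boundary_morphism n) (in_setT b) bi).
Qed.

(** One value of each mirror pair is kept, so that [norm] gives back the
    invariant cochain. *)
Definition oriented_lift p c : cochain n p.+2 := orient (lift_chain p c).

Lemma norm_oriented_lift p c : norm (oriented_lift p c) = lift_chain p c.
Proof. exact/norm_orient/norm_lift_chain. Qed.

Lemma oriented_liftD p c d : oriented_lift p (c + d) =
  oriented_lift p c + oriented_lift p d.
Proof.
apply/ffunP=> x; rewrite !ffunE chain_atD.
by case: ifP => _; rewrite ?addr0.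
Qed.

Lemma cocycle_oriented_lift p c : c \in chains n (degree p) ->
  is_cocycle (oriented_lift p c) <-> c \in cycles n (degree p).
Proof.
move=> cp; rewrite mem_cycles cp /is_cocycle norm_coboundary norm_oriented_lift
  coboundary_lift_chain.
split=> [bc|/eqP->]; last exact: lift_chain0.
apply/eqP; apply: (@lift_chain_inj p.+1); rewrite ?lift_chain0 ?chains0 //.
by apply: boundary_chains; rewrite -degree_next.
Qed.

Lemma top_chains c : c \in chains n (degree 0 + 1) -> c = 0.
Proof.
move=> /mem_chains c0; apply/ffunP=> F; rewrite ffunE c0 //.
have [q [w [wv FE]]] := cell_orbit F; rewrite (dim_orbit wv FE) /degree.
by apply/eqP; lia.
Qed.

(** In top degree there is no chain to take the boundary of; accordingly,
    [norm (coboundary v)] vanishes there, because [v] has degree [1]. *)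
Lemma trivial_oriented_lift p c : c \in chains n (degree p) ->
  is_trivial (oriented_lift p c) <-> c \in boundaries n (degree p).
Proof.
move=> cp; rewrite mem_boundaries /= norm_oriented_lift; case: p cp => [|p] cp.
  split=> [[v]|[b /top_chains-> ->]]; last first.
    by exists 0; rewrite boundary0 lift_chain0 coboundary0 norm0.
  rewrite norm_coboundary norm1 coboundary0 -(lift_chain0 0) => /(lift_chain_inj cp)->.
    by exists 0; rewrite ?chains0 ?boundary0.
  exact: chains0.
rewrite -degree_next; split=> [[v cv]|[b bp ->]]; last first.
  by exists (oriented_lift p b); rewrite norm_coboundary norm_oriented_lift
    coboundary_lift_chain.
exists (descend (norm v)); first exact: descend_chains.
apply: (lift_chain_inj cp); first by apply: boundary_chains;
  rewrite -degree_next descend_chains.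
by rewrite -coboundary_lift_chain lift_chainK ?normK // cv norm_coboundary.
Qed.

(** Chains and cochains up to [norm] correspond to each other, so the additive
    map provided by [betti] factors through the homology group. *)
Lemma homology_betti p k : betti n p.+2 k ->
  homology n (degree p) \isog [set: 'rV['Z_2]_k].
Proof.
case=> phi [phiD phi0 phi_onto].
pose f (c : chain n) : 'rV['Z_2]_k := phi (oriented_lift p c).
have fM : {in cycles n (degree p) &, {morph f : c d / (c * d)%g}}.
  by move=> c d _ _; rewrite /f oriented_liftD phiD.
pose fm := Morphism fM.
have cyc_half c : c \in cycles n (degree p) ->
  is_cocycle (oriented_lift p c) /\ c \in chains n (degree p).
  move=> cc; have cp : c \in chains n (degree p) by move: cc; rewrite mem_cycles => /andP[].
  by split=> //; apply/cocycle_oriented_lift.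
have kerE : ('ker fm)%g = boundaries n (degree p).
  apply/setP=> c; apply/idP/idP => [|cb].
    move/morphpreP=> [cc]; rewrite inE => /eqP fc.
    have [ch cp] := cyc_half c cc.
    by apply/(trivial_oriented_lift cp)/(phi0 _ ch).
  have cc : c \in cycles n (degree p).
    have /mem_boundaries[b bp cE] := cb.
    have cp : c \in chains n (degree p) by rewrite cE boundary_chains.
    apply/(cocycle_oriented_lift cp); have := (trivial_oriented_lift cp).2 cb.
    case=> v hv; rewrite /is_cocycle norm_coboundary hv -norm_coboundary.
    by rewrite coboundaryK norm0.
  have [ch cp] := cyc_half c cc.
  apply/morphpreP; split=> //; rewrite inE; apply/eqP.
  by apply/(phi0 _ ch)/(trivial_oriented_lift cp).
have imE : (fm @* cycles n (degree p))%g = [set: 'rV['Z_2]_k].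
  apply/setP=> t; rewrite inE; have [u cu <-] := phi_onto t.
  have dp := descend_chains (norm u).
  have Nh : norm (oriented_lift p (descend (norm u)) + u) = 0.
    by rewrite normD norm_oriented_lift lift_chainK ?normK ?cochain_addxx.
  have dh : is_cocycle (oriented_lift p (descend (norm u))).
    by rewrite /is_cocycle norm_coboundary norm_oriented_lift lift_chainK ?normK //
      -norm_coboundary.
  apply/morphimP; exists (descend (norm u)); try exact/cocycle_oriented_lift.
  have hu : phi (oriented_lift p (descend (norm u)) + u) = 0.
    apply/phi0; first exact: cocycleD.
    by exists 0; rewrite Nh coboundary0 norm0.
  rewrite /= /f -[X in _ = phi X]addr0 -(cochain_addxx u) addrA phiD.
  by rewrite hu add0r.
by have := first_isog fm; rewrite imE kerE.
Qed.

Lemma homology_trivial i : (forall p, (p.+2 <= n)%N -> degree p != i) ->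
  homology n i = 1%G.
Proof.
move=> iN; have ci : cycles n i = 1%G.
  apply/trivGP/subsetP => c; rewrite mem_cycles => /andP[/mem_chains ci _].
  apply/set1P/ffunP => F; rewrite ci; first by rewrite ffunE.
  have [p [w [wv FE]]] := cell_orbit F; rewrite (dim_orbit wv FE); apply: iN.
  by case/andP: wv => wp wo; apply: onto_le_size wp wo.
by rewrite /homology ci; apply: val_inj; apply: quotient1.
Qed.
End Transfer.

Lemma degree_of n i : (2 <= n)%N -> (i <= n - 2)%N -> Posz i = degree n (n - 2 - i).
Proof. rewrite /degree; lia. Qed.

Theorem theorem1p5 (n : nat) (hn : (2 <= n)%N) :
  (forall i : nat, (i <= n - 2)%N ->
     homology n (Posz i) \isog [set: 'rV['Z_2]_(xi n i)]%g) /\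
  (forall i : int, ~~ ((0 <= i)%R && (i <= Posz n - 2)%R) ->
     homology n i = 1%G).
Proof.
split=> [i i_n|i iN]; last first.
  apply: homology_trivial => p pn; apply: contra iN => /eqP<-.
  by rewrite /degree; lia.
rewrite (degree_of hn i_n).
have -> : xi n i = upper_binomial n (n - 2 - i).+2.
  rewrite upper_binomial_xi; last by lia.
  by have -> : n - (n - 2 - i).+2 = i by lia.
exact/homology_betti/betti_upper_binomial.
Qed.
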